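(* For every $k\in\mathbb{N}=\{1,2,3,\dots\}$, \[ \Phi_8(k)=F_8(k):=\max_{1\le j\le k}\frac{j}{j+\lceil 2\sqrt{j}\,\rceil+1},\qquad \Phi_4(k)\le F_4(k):=\max_{1\le j\le k}\frac{j}{j+\frac{\lceil 2\sqrt{2j-1}\,\rceil}{2}} . \] Moreover, $\Phi_4(k)=F_4(k)$ for every $k\in\mathcal{S}$, and $\Phi_4(k)<F_4(k)$ for every $k\in\mathcal{U}$, where \[ \mathcal{S}:=\mathbb{N}\cap\bigcup_{n=1}^{\infty}\Big(\Big[s_0(n)-\tfrac n2,\ s_0(n)+\tfrac{n-1}{2}\Big]\cup\Big[s_2(n)-\tfrac n2,\ s_2(n)+\tfrac n2\Big]\Big)=\{1,2,4,5,7,8,9,12,13,14,17,18,19,23,24,25,26,30,\dots\}, \] \[ \mathcal{U}:=\mathbb{N}_{\ge 2}\cap\bigcup_{n=1}^{\infty}\Big(\Big[s_1(n),\ s_1(n)+\tfrac{n-1}{2}\Big]\cup\Big[s_3(n),\ s_3(n)+\tfrac n2\Big]\Big)=\{3,6,10,11,15,16,21,22,28,29,\dots\}, \] with $s_0(n)=(n-1)^2+n^2$, $s_1(n)=n(2n-1)$, $s_2(n)=2n^2$, $s_3(n)=n(2n+1)$.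
   Context: An infinite binary image is a map $I:\mathbb{Z}^2\to\{\text{black},\text{white}\}$; its elements are pixels. For $x,y\in\mathbb{Z}^2$ let $d_4(x,y)=|x_1-y_1|+|x_2-y_2|$ and $d_8(x,y)=\max\{|x_1-y_1|,|x_2-y_2|\}$; for $\alpha\in\{4,8\}$, $x,y$ are $\alpha$-adjacent if $d_\alpha(x,y)=1$. Two pixels are $\alpha$-connected if they are equal or joined by a sequence of pixels each $\alpha$-adjacent to its predecessor; a white $\alpha$-connected component of $I$ is a maximal set of mutually $\alpha$-connected white pixels (connected within the white pixels), and its size is its number of pixels. The white pixel density of $I$ is $\rho(I)=\liminf_{j\to\infty,\ j\text{ odd}} W_j/j^2$, where $W_j$ is the number of white pixels in the $j\times j$ box of pixels centered at the origin. For $\alpha\in\{4,8\}$ and $k\in\mathbb{N}$, $\Phi_\alpha(k)$ is the supremum of $\rho(I)$ over all infinite binary images $I$ all of whose white $\alpha$-connected components have size at most $k$. *)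

(* Defs.v *)
From mathcomp Require Import all_boot all_order all_algebra.
From mathcomp Require Import all_classical all_reals all_analysis.

Set Implicit Arguments.
Unset Strict Implicit.
Unset Printing Implicit Defensive.

Import Order.TTheory GRing.Theory Num.Theory.

Local Open Scope classical_set_scope.
Local Open Scope ring_scope.

Definition pixel : Type := (int * int)%type.

(* [true] is white, [false] is black. *)
Definition binary_image : Type := pixel -> bool.

Definition white (I : binary_image) : set pixel := [set x | I x].

Definition d4 (x y : pixel) : nat := (`|x.1 - y.1| + `|x.2 - y.2|)%N.

Definition d8 (x y : pixel) : nat := maxn `|x.1 - y.1|%N `|x.2 - y.2|%N.

(* The adjacency parameter alpha in {4, 8} is represented by the corresponding
   distance [d] in {d4, d8}. *)
Definition adjacent (d : pixel -> pixel -> nat) : rel pixel :=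
  fun x y => d x y == 1%N.

(* The case [p = [::]] is [x = y]. *)
Definition connected_within (d : pixel -> pixel -> nat) (A : set pixel)
    (x y : pixel) : Prop :=
  exists p : seq pixel,
    [/\ path (adjacent d) x p, last x p = y & forall z, z \in x :: p -> A z].

Definition mutually_connected (d : pixel -> pixel -> nat) (I : binary_image)
    (C : set pixel) : Prop :=
  C `<=` white I /\
  forall x y, C x -> C y -> connected_within d (white I) x y.

(* If [I] has no white pixel, the only such [C] is the empty set, of size 0;
   otherwise [C] is nonempty. *)
Definition white_component (d : pixel -> pixel -> nat) (I : binary_image)
    (C : set pixel) : Prop :=
  mutually_connected d I C /\
  forall D, mutually_connected d I D -> C `<=` D -> D = C.

(* [C #<= `I_k] says that [C] is finite with at most [k] elements. *)
Definition components_le (d : pixel -> pixel -> nat) (k : nat) (I : binary_image) :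
    Prop :=
  forall C, white_component d I C -> (C #<= `I_k)%card.

(* W_j for odd j: coordinates range over -(j-1)/2, ..., (j-1)/2. *)
Definition white_count (I : binary_image) (j : nat) : nat :=
  #|[set p : 'I_j * 'I_j |
      I (p.1%:Z - (j./2)%:Z, p.2%:Z - (j./2)%:Z)]|%SET.

(* The n-th term is the one for the n-th odd number j = 2n+1. *)
Definition white_density (R : realType) (I : binary_image) : R :=
  limn_inf (fun n : nat =>
    (white_count I n.*2.+1)%:R / (n.*2.+1)%:R ^+ 2 : R).

Definition Phi (R : realType) (d : pixel -> pixel -> nat) (k : nat) : R :=
  sup [set white_density R I | I in [set I | components_le d k I]].

(* The fraction being maximized is positive, so the default value 0 of the
   iterated maximum plays no role when k >= 1. *)
Definition F8 (R : realType) (k : nat) : R :=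
  \big[Num.max/0]_(1 <= j < k.+1)
    (j%:R / (j%:R + (Num.ceil (2 * Num.sqrt (j%:R : R)))%:~R + 1)).

Definition F4 (R : realType) (k : nat) : R :=
  \big[Num.max/0]_(1 <= j < k.+1)
    (j%:R / (j%:R + (Num.ceil (2 * Num.sqrt (2 * j%:R - 1 : R)))%:~R / 2)).

Definition s0 (n : nat) : rat := (n%:R - 1) ^+ 2 + n%:R ^+ 2.
Definition s1 (n : nat) : rat := n%:R * (2 * n%:R - 1).
Definition s2 (n : nat) : rat := 2 * n%:R ^+ 2.
Definition s3 (n : nat) : rat := n%:R * (2 * n%:R + 1).

Definition S_set : set nat :=
  [set k | (1 <= k)%N] `&`
  \bigcup_(n in [set n | (1 <= n)%N])
    ([set k | k%:R \in `[s0 n - n%:R / 2, s0 n + (n%:R - 1) / 2]] `|`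
     [set k | k%:R \in `[s2 n - n%:R / 2, s2 n + n%:R / 2]]).

Definition U_set : set nat :=
  [set k | (2 <= k)%N] `&`
  \bigcup_(n in [set n | (1 <= n)%N])
    ([set k | k%:R \in `[s1 n, s1 n + (n%:R - 1) / 2]] `|`
     [set k | k%:R \in `[s3 n, s3 n + n%:R / 2]]).

(* Main.v *)
Require Import Defs.
From mathcomp Require Import all_boot all_order all_algebra.
From mathcomp Require Import all_classical all_reals all_analysis.
From mathcomp Require Import zify ring lra.

(** For 8-connectivity the sets [C + {0,1}^2], for [C] a white component, are pairwise
    disjoint, and a component with [w] occupied columns and [h] occupied rows satisfies
    [|C| <= w h] and [|C + {0,1}^2| >= |C| + w + h + 1].

    For 4-connectivity use the coordinates [u = x + y] and [v = x - y].  An exit of [C] is a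
    diagonal step leaving [C].  In every 2x2 block there are at most as many exits as black
    pixels, and each black pixel lies in four blocks.  If [C] meets exactly [a] lines [u = const]
    and [b] lines [v = const], it has at least [2 (a + b)] exits, and by connectedness it lies in
    an [a x b] box of the [(u, v)]-lattice, half of whose points are pixels, so [2 |C| <= a b + 1].

    For [k] in [U], only full boxes with sides [P] and [P + 1] are optimal.  Such a component has
    two adjacent pointed corners and two flat sides of length two.  If there is no loss, an end
    of each flat side faces a pointed corner of a third component, and as each flat side is shared
    by two components, this uses up all the pointed corners.  But then the component beyond the side
    joining the two pointed corners of [C] must extend past that side by one line at each end, so it
    is a box with a side of length [2] more than a side of [C], while [P] and [P + 1] differ by [1].
    Hence losses have positive density.

    The extremal images colour a pixel according to the residue of a linear form modulo [N],
    except for [k = (n-1)^2 + n^2] where diamonds are separated by full diagonal lines. *)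

Set Implicit Arguments.
Unset Strict Implicit.
Unset Printing Implicit Defensive.

Import Order.TTheory GRing.Theory Num.Theory.

Local Open Scope classical_set_scope.
Local Open Scope ring_scope.

(** * Connectivity *)

Definition shift (d z : pixel) : pixel := (z.1 + d.1, z.2 + d.2).

Definition antipode (d : pixel) : pixel := (- d.1, - d.2).

Lemma pixel_eq (a b c d : int) : a = c -> b = d -> (a, b) = (c, d) :> pixel.
Proof. by move=> -> ->. Qed.

Lemma shift_inj d : injective (shift d).
Proof.
by move=> [a b] [a' b'] [] /= h1 h2; apply: pixel_eq; [move: h1 | move: h2]; lia.
Qed.

Lemma shiftK d : cancel (shift d) (shift (antipode d)).
Proof. by move=> [a b]; apply: pixel_eq => /=; lia. Qed.

Lemma shiftNK d : cancel (shift (antipode d)) (shift d).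
Proof. by move=> [a b]; apply: pixel_eq => /=; lia. Qed.

Section Connectivity.
Variables (d : pixel -> pixel -> nat).
Hypothesis dC : forall x y, d x y = d y x.

Lemma connected_refl (A : set pixel) x : A x -> connected_within d A x x.
Proof. by move=> Ax; exists [::]; split => // z; rewrite inE => /eqP ->. Qed.

Lemma connected_trans (A : set pixel) y x z :
  connected_within d A x y -> connected_within d A y z -> connected_within d A x z.
Proof.
move=> [p [pp lp Ap]] [q [pq lq Aq]]; exists (p ++ q); split.
- by rewrite cat_path pp lp.
- by rewrite last_cat lp.
- move=> t; rewrite inE mem_cat => /or3P[/eqP->|tp|tq].
  + by apply: Ap; rewrite inE eqxx.
  + by apply: Ap; rewrite inE tp orbT.
  + by apply: Aq; rewrite inE tq orbT.
Qed.

Lemma connected_step (A : set pixel) x y :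
  A x -> A y -> Defs.adjacent d x y -> connected_within d A x y.
Proof.
move=> Ax Ay xy; exists [:: y]; split => //=; first by rewrite xy.
by move=> z; rewrite !inE => /orP[] /eqP ->.
Qed.

Lemma connected_sym (A : set pixel) x y :
  connected_within d A x y -> connected_within d A y x.
Proof.
case=> p [pp <- Ap] {y}; elim: p x pp Ap => [|y p IH] x /=.
  by move=> _ Ap; apply: connected_refl; apply: Ap; rewrite inE.
case/andP => xy pp Ap.
apply: (@connected_trans _ y).
  by apply: IH => // z zp; apply: Ap; rewrite inE zp orbT.
apply: connected_step.
- by apply: Ap; rewrite !inE eqxx orbT.
- by apply: Ap; rewrite inE eqxx.
- by rewrite /Defs.adjacent dC.
Qed.

Lemma connected_l (A : set pixel) x y : connected_within d A x y -> A x.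
Proof. by case=> p [_ _]; apply; rewrite inE eqxx. Qed.

Lemma connected_r (A : set pixel) x y : connected_within d A x y -> A y.
Proof. by move=> /connected_sym /connected_l. Qed.

Lemma connected_sub (A B : set pixel) x y : A `<=` B ->
  connected_within d A x y -> connected_within d B x y.
Proof. by move=> AB [p [pp lp Ap]]; exists p; split => // z /Ap /AB. Qed.

Lemma connected_in_class (A : set pixel) x y : connected_within d A x y ->
  connected_within d [set z | connected_within d A x z] x y.
Proof.
case=> p [pp <- Ap] {y}; elim/last_ind: p pp Ap => [|p y IH].
  by move=> _ Ap; apply: connected_refl; apply: connected_refl; apply: Ap; rewrite inE.
rewrite rcons_path last_rcons => /andP[pp py] Ap.
have Ap' : forall z, z \in x :: p -> A z.
  by move=> z; rewrite inE => zp; apply: Ap; rewrite inE mem_rcons inE;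
     case/orP: zp => ->; rewrite ?orbT.
have {}IH : connected_within d [set z | connected_within d A x z] x (last x p).
  exact: IH.
apply: (connected_trans IH); have xl := connected_r IH.
apply: connected_step => //=; apply: (connected_trans xl).
apply: connected_step => //; first exact: connected_r xl.
by apply: Ap; rewrite inE mem_rcons inE eqxx !orbT.
Qed.

Lemma class_component (I : binary_image) x : I x ->
  white_component d I [set y | connected_within d (white I) x y].
Proof.
move=> Ix; split.
  split; first by move=> y /connected_r.
  by move=> y z xy xz; apply: connected_trans xz; apply: connected_sym.
move=> D [DI Dc] CD; apply/seteqP; split=> // y Dy.
by apply: Dc => //; apply: CD; apply: connected_refl.
Qed.

Definition component (W : seq pixel) (x : pixel) : seq pixel :=
  [seq y <- W | `[< connected_within d [set` W] x y >]].

Lemma mem_component W x y :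
  reflect (connected_within d [set` W] x y) (y \in component W x).
Proof.
rewrite mem_filter; apply: (iffP andP) => [[/asboolP //]|h].
by split; [apply/asboolP | apply: connected_r h].
Qed.

Lemma component_sub W x y : y \in component W x -> y \in W.
Proof. by rewrite mem_filter => /andP[]. Qed.

Lemma component_self W x : x \in W -> x \in component W x.
Proof. by move=> xW; apply/mem_component/connected_refl. Qed.

Lemma component_step W x y z : y \in component W x -> z \in W -> Defs.adjacent d y z ->
  z \in component W x.
Proof.
move=> /mem_component xy zW yz; apply/mem_component.
by apply: (connected_trans xy); apply: connected_step => //; exact: connected_r xy.
Qed.

Lemma component_connected W x y z : y \in component W x -> z \in component W x ->
  connected_within d [set` component W x] y z.
Proof.
move=> /mem_component xy /mem_component xz.
suff H t : connected_within d [set` W] x t ->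
    connected_within d [set` component W x] x t.
  by apply: connected_trans (H _ xz); apply: connected_sym; apply: H.
move=> /connected_in_class; apply: connected_sub => s xs.
by apply/mem_component.
Qed.

Lemma component_size W (I : binary_image) k x : uniq W -> {subset W <= I} ->
  components_le d k I -> x \in W -> (size (component W x) <= k)%N.
Proof.
move=> uW WI Ik xW; have := Ik _ (class_component (WI _ xW)).
set C := [set y | _] => Ck.
have finC : finite_set C by apply/finite_set_leP; exists k.
apply: leq_trans (geq_card_fset_set Ck).
apply: uniq_leq_size; first exact: filter_uniq.
move=> y /mem_component xy; rewrite in_fset_set // inE.
by apply: connected_sub xy => z; exact: WI.
Qed.

End Connectivity.

Lemma d4C x y : d4 x y = d4 y x.
Proof. by rewrite /d4 (distnC x.1) (distnC x.2). Qed.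

Lemma d8C x y : d8 x y = d8 y x.
Proof. by rewrite /d8 (distnC x.1) (distnC x.2). Qed.

(** * Sums over components *)

Lemma class_sum (R : numDomainType) (T : eqType) (S : rel T) (s : seq T) (F G : T -> R) :
  {in s, forall x, S x x} -> {in s & &, forall x y z, S x y -> S x z -> S y z} ->
  {in s, forall x, \sum_(y <- s | S x y) G y <= \sum_(y <- s | S x y) F y} ->
  \sum_(x <- s) G x <= \sum_(x <- s) F x.
Proof.
have [n] := ubnP (size s); elim: n s => // n IH [|x s] sn rS tS le.
  by rewrite !big_nil.
set t := x :: s in sn rS tS le *.
have xt : x \in t by rewrite inE eqxx.
rewrite (bigID (S x)) [leRHS](bigID (S x)) /= lerD //; first exact: le.
rewrite -!(big_filter _ (fun y => ~~ S x y)).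
have sub : {subset [seq y <- t | ~~ S x y] <= t} by apply: mem_subseq; exact: filter_subseq.
apply: IH.
- have : (0 < count (S x) t)%N by rewrite -has_count; apply/hasP; exists x => //; exact: rS.
  have : count (fun y => ~~ S x y) t = count (predC (S x)) t by exact: eq_count.
  by rewrite size_filter; have := count_predC (S x) t; move: sn; rewrite -/t; lia.
- by move=> y /sub; exact: rS.
- by move=> y z w /sub yt /sub zt /sub wt; exact: tS.
move=> y yf; have yt := sub _ yf; have := le y yt.
rewrite !big_filter_cond.
have E z : z \in t -> ~~ S x z && S y z = S y z.
  move=> zt; apply: andb_idl => yz; apply: contraL yf => xz.
  rewrite mem_filter negb_and negbK; apply/orP; left.
  have zx := tS _ _ _ xt zt xt xz (rS _ xt).
  apply: (tS z x y) => //; apply: (tS y) => //; exact: rS.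
have EH (H : T -> R) :
    \sum_(z <- t | ~~ S x z && S y z) H z = \sum_(z <- t | S y z) H z.
  by rewrite big_seq_cond [RHS]big_seq_cond; apply: eq_bigl => z; apply: andb_id2l; exact: E.
by rewrite !EH.
Qed.

Lemma sum_components (R : numDomainType) (d : pixel -> pixel -> nat) (W : seq pixel)
    (F G : pixel -> R) : (forall x y, d x y = d y x) ->
  {in W, forall x, \sum_(y <- component d W x) G y <= \sum_(y <- component d W x) F y} ->
  \sum_(x <- W) G x <= \sum_(x <- W) F x.
Proof.
move=> dC le; apply: (@class_sum _ _ (fun x y => `[< connected_within d [set` W] x y >])).
- by move=> x xW; apply/asboolP/connected_refl.
- move=> x y z _ _ _ /asboolP xy /asboolP xz; apply/asboolP.
  by apply: connected_trans xz; exact: connected_sym.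
- by move=> x /le; rewrite !big_filter.
Qed.

Lemma sum_components_nat (d : pixel -> pixel -> nat) (W : seq pixel) (F G : pixel -> nat) :
  (forall x y, d x y = d y x) ->
  {in W, forall x, \sum_(y <- component d W x) G y <= \sum_(y <- component d W x) F y}%N ->
  (\sum_(x <- W) G x <= \sum_(x <- W) F x)%N.
Proof.
move=> dC le; rewrite -(ler_nat int) !natr_sum; apply: (sum_components dC) => x /le.
by rewrite -(ler_nat int) !natr_sum.
Qed.

Lemma sum_shift_le (B W : seq pixel) (d : pixel) (G : pixel -> nat) : uniq B -> uniq W ->
  {in W, forall z, shift d z \in B} ->
  (\sum_(z <- W) G (shift d z) <= \sum_(b <- B) G b)%N.
Proof.
move=> uB uW WB; rewrite -(big_map (shift d) xpredT G).
have uWd : uniq (map (shift d) W) by rewrite map_inj_uniq //; exact: shift_inj.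
rewrite [leqRHS](bigID (mem (map (shift d) W))) /=.
rewrite -[X in (_ <= X + _)%N]big_filter.
have P : perm_eq [seq i <- B | i \in map (shift d) W] (map (shift d) W).
  apply: uniq_perm => //; first exact: filter_uniq.
  move=> z; rewrite mem_filter; apply: andb_idr => /mapP [w wW ->]; exact: WB.
by rewrite (perm_big _ P) leq_addr.
Qed.

Lemma sum_shift_mem (B W : seq pixel) (d : pixel) (G : pixel -> nat) : uniq B -> uniq W ->
  {in W, forall z, shift (antipode d) z \in B} ->
  (\sum_(b <- B) (shift d b \in W) * G (shift d b) = \sum_(z <- W) G z)%N.
Proof.
move=> uB uW WB.
rewrite [RHS](perm_big [seq z <- map (shift d) B | z \in W]).
  rewrite big_filter big_map [RHS]big_mkcond /=; apply: eq_bigr => b _.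
  by case: ifP; rewrite ?mul1n ?mul0n.
apply: uniq_perm => //.
  by rewrite filter_uniq // map_inj_uniq //; exact: shift_inj.
move=> z; rewrite mem_filter andb_idr // => zW.
by rewrite -(shiftNK d z); apply/map_f/WB.
Qed.

Lemma seq_min (s : seq int) x0 : x0 \in s -> exists2 m, m \in s & {in s, forall x, m <= x}.
Proof.
elim: s x0 => // x s IH x0 _; case: s IH => [|y s] IH.
  by exists x; rewrite ?inE // => z; rewrite inE => /eqP ->.
have [m ms lem] := IH y (mem_head _ _).
have [xm|mx] := leP x m.
  exists x; first exact: mem_head.
  by move=> z; rewrite inE => /orP[/eqP ->//|/lem]; apply: le_trans.
exists m; first by rewrite inE ms orbT.
by move=> z; rewrite inE => /orP[/eqP ->|/lem //]; exact: ltW.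
Qed.

Lemma path_range (d : pixel -> pixel -> nat) (A : set pixel) (u : pixel -> int) x y (c : int) :
  (forall z t, Defs.adjacent d z t -> u t <= u z + 1) ->
  connected_within d A x y -> u x <= c -> c <= u y -> exists2 z, A z & u z = c.
Proof.
move=> st [p [pp <- Ap]] {y}; elim: p x pp Ap => [|y p IH] x /=.
  by move=> _ Ap xc cx; exists x; [apply: Ap; rewrite inE | lia].
move=> /andP[xy pp] Ap xc cy; have [ux|ux] := eqVneq (u x) c.
  by exists x => //; apply: Ap; rewrite inE eqxx.
have := st _ _ xy => xy1; apply: (IH y) => //; last by lia.
by move=> z zp; apply: Ap; rewrite inE zp orbT.
Qed.

Lemma component_range (d : pixel -> pixel -> nat) (W : seq pixel) (u : pixel -> int) x :
  (forall x y, d x y = d y x) ->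
  (forall z t, Defs.adjacent d z t -> u t <= u z + 1) -> x \in W ->
  exists (u0 : int) (a : nat),
    {in component d W x, forall z, u0 <= u z < u0 + a%:Z} /\
    forall c, u0 <= c < u0 + a%:Z -> exists2 z, z \in component d W x & u z = c.
Proof.
move=> dC st xW; have xK := component_self dC xW; set K := component d W x in xK *.
have [m /mapP[y yK my] lem] := seq_min (map_f u xK).
have [M /mapP[z zK Mz] leM] := seq_min (map_f (fun z => - u z) xK).
exists m, (absz (- M - m + 1)).
have h t : t \in K -> m <= u t <= - M.
  by move=> tK; have := lem _ (map_f u tK); have := leM _ (map_f (fun z => - u z) tK); lia.
split=> [t /h|c cr]; first by have := h _ xK; lia.
have := component_connected dC yK zK => yz.
have yc : u y <= c by lia.
have cz : c <= u z by have := h _ xK; lia.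
by have [t tK tc] := path_range st yz yc cz; exists t.
Qed.

(* On each line of direction [d] that meets [K], the last pixel of [K] is an
   exit. *)
Lemma exits_dir (K : seq pixel) (d : pixel) (v : pixel -> int) (v0 : int) (b : nat) :
  uniq K -> (d.1 != 0) || (d.2 != 0) -> (forall z, v (shift d z) = v z) ->
  (forall c : int, v0 <= c < v0 + b%:Z -> exists2 z, z \in K & v z = c) ->
  (b <= \sum_(z <- K) (shift d z \notin K))%N.
Proof.
move=> uK d0 vd vK.
have last_in z : z \in K -> exists2 y, (y \in K) && (shift d y \notin K) & v y = v z.
  move=> zK; apply: contrapT => h.
  have it i : iter i (shift d) z \in K /\ v (iter i (shift d) z) = v z.
    elim: i => [//|i [iK iv]] /=; rewrite vd; split=> //.
    by apply: contrapT => /negP niK; apply: h; exists (iter i (shift d) z); rewrite ?iK.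
  have it1 i : (iter i (shift d) z).1 = z.1 + d.1 * i%:Z /\
               (iter i (shift d) z).2 = z.2 + d.2 * i%:Z.
    elim: i => [|i IH] /=; first by rewrite !mulr0 !addr0.
    by rewrite IH.1 IH.2 intS; split; ring.
  have : uniq [seq iter i (shift d) z | i <- iota 0 (size K).+1].
    rewrite map_inj_uniq ?iota_uniq // => i j ij.
    have [[e1 e2] [e3 e4]] := (it1 i, it1 j); rewrite ij in e1 e2.
    case/orP: d0 => d0.
      have /(mulfI d0) [] // : d.1 * i%:Z = d.1 * j%:Z by lia.
    by have /(mulfI d0) [] // : d.2 * i%:Z = d.2 * j%:Z by lia.
  move=> /uniq_leq_size leK.
  have /leK : {subset [seq iter i (shift d) z | i <- iota 0 (size K).+1] <= K}.
    by move=> _ /mapP[i _ ->]; case: (it i).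
  by rewrite size_map size_iota ltnn.
rewrite -big_mkcond /= sum1_count -size_filter.
have := @uniq_leq_size _ [seq v0 + i%:Z | i <- iota 0 b] (map v [seq y <- K | shift d y \notin K]).
rewrite !size_map size_iota; apply.
  by rewrite map_inj_uniq ?iota_uniq // => i j; lia.
move=> c /mapP[i]; rewrite mem_iota => ib ->.
have [|z zK zc] := vK (v0 + i%:Z); first by lia.
have [y yK yz] := last_in z zK; rewrite -zc -yz; apply: map_f.
by rewrite mem_filter andbC.
Qed.

(** * Boxes and exits *)

Definition inbox (u0 v0 : int) (a b : nat) (z : pixel) : bool :=
  (u0 <= z.1 + z.2 < u0 + a%:Z) && (v0 <= z.1 - z.2 < v0 + b%:Z).

Lemma half_index_inj (i j i' j' : int) (b : nat) : 0 <= j < b%:Z -> 0 <= j' < b%:Z ->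
  (i + j == i' + j' %[mod 2])%Z ->
  ((i * b%:Z + j) %/ 2)%Z = ((i' * b%:Z + j') %/ 2)%Z -> i = i' /\ j = j'.
Proof.
move=> hj hj' par e.
have close : -1 <= (i' - i) * b%:Z + (j' - j) <= 1.
  by rewrite mulrBl; lia.
have [ii|ii] := eqVneq i i'; first by subst i'; split => //; lia.
exfalso.
have [lt|lt] : i' - i >= 1 \/ i - i' >= 1 by lia.
  have i1 : i' = i + 1.
    have : (i' - i) * b%:Z >= (i' - i - 1) * b%:Z + b%:Z by lia.
    by nia.
  subst i'; have : j = b%:Z - 1 /\ j' = 0 by lia.
  case=> ej ej'; subst j j'; have : (b = 2 * (b %/ 2))%N by lia.
  by set c := (b %/ 2)%N => bc; rewrite bc in e close par *; lia.
have i1 : i = i' + 1.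
  have : (i - i') * b%:Z >= (i - i' - 1) * b%:Z + b%:Z by lia.
  by nia.
subst i; have : j' = b%:Z - 1 /\ j = 0 by lia.
case=> ej ej'; subst j j'; have : (b = 2 * (b %/ 2))%N by lia.
by set c := (b %/ 2)%N => bc; rewrite bc in e close par *; lia.
Qed.

(* The coordinates [x + y] and [x - y] of a pixel have the same parity, so a box
   in these coordinates is only half filled with pixels. *)
Lemma inbox_card (K : seq pixel) u0 v0 a b : uniq K -> {subset K <= inbox u0 v0 a b} ->
  (2 * size K <= a * b + 1)%N.
Proof.
move=> uK Kb.
pose t (z : pixel) := absz (((z.1 + z.2 - u0) * b%:Z + (z.1 - z.2 - v0)) %/ 2)%Z.
have bd (z : pixel) : z \in K -> 0 <= (z.1 + z.2 - u0) * b%:Z + (z.1 - z.2 - v0) < (a * b)%:Z.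
  move=> /Kb /andP[h1 h2].
  have : 0 <= (z.1 + z.2 - u0) * b%:Z <= (a%:Z - 1) * b%:Z.
    by apply/andP; split; [apply: mulr_ge0 | apply: ler_wpM2r]; lia.
  by rewrite mulrBl PoszM; lia.
have tinj (z w : pixel) : z \in K -> w \in K -> t z = t w -> z = w.
  move=> zK wK tzw.
  have /andP[h1 h2] := Kb _ zK; have /andP[h3 h4] := Kb _ wK.
  have := bd _ zK; have := bd _ wK; move: tzw; rewrite /t => tzw b1 b2.
  have [||||e1 e2] := @half_index_inj (z.1 + z.2 - u0) (z.1 - z.2 - v0)
     (w.1 + w.2 - u0) (w.1 - w.2 - v0) b; try lia.
  by case: z w {zK wK tzw h1 h2 h3 h4 b1 b2} e1 e2 => [z1 z2] [w1 w2] /= *; apply: pixel_eq; lia.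
have : uniq (map t K) by rewrite map_inj_in_uniq.
move=> /uniq_leq_size leK.
have /leK : {subset map t K <= iota 0 ((a * b + 1) %/ 2)}.
  by move=> _ /mapP[z /bd h ->]; rewrite mem_iota /t; lia.
by rewrite size_map size_iota; lia.
Qed.

Lemma inbox_full (K : seq pixel) u0 v0 a b : uniq K -> {subset K <= inbox u0 v0 a b} ->
  (a * b <= 2 * size K)%N -> ~~ odd (a * b) -> {subset inbox u0 v0 a b <= K}.
Proof.
move=> uK Kb sK ev z zb; apply/negPn/negP => zK.
have : (2 * size (z :: K) <= a * b + 1)%N.
  apply: (@inbox_card _ u0 v0); first by rewrite /= zK.
  by move=> w; rewrite inE => /orP[/eqP->|/Kb].
by rewrite /=; lia.
Qed.

Lemma adjacent4P (x y : pixel) : Defs.adjacent d4 x y <->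
  y \in [:: shift (1, 0) x; shift (-1, 0) x; shift (0, 1) x; shift (0, -1) x].
Proof.
case: x y => [x1 x2] [y1 y2]; rewrite /Defs.adjacent /d4 !inE /shift /= !xpair_eqE /=.
by split; lia.
Qed.

Definition diagonals : seq pixel := [:: (1, 1); (-1, -1); (1, -1); (-1, 1)].

Definition exits (W : seq pixel) (z : pixel) : nat :=
  (\sum_(d <- diagonals) (shift d z \notin component d4 W z))%N.

Lemma mem_component_class (W : seq pixel) x y : y \in component d4 W x ->
  component d4 W y =i component d4 W x.
Proof.
move=> /(mem_component d4C) xy z; apply/(mem_component d4C)/(mem_component d4C) => h.
  exact: connected_trans h.
by apply: connected_trans h; apply: (connected_sym d4C).
Qed.

Lemma component_exits (W : seq pixel) x : uniq W -> x \in W ->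
  exists (u0 v0 : int) (a b : nat),
   {subset component d4 W x <= inbox u0 v0 a b} /\
   (2 * (a + b) <= \sum_(z <- component d4 W x) exits W z)%N.
Proof.
move=> uW xW; set K := component d4 W x; have uK : uniq K by exact: filter_uniq.
have [u0 [a [ub ua]]] := component_range d4C (u := fun z => z.1 + z.2)
  (fun z t zt => ltac:(move/adjacent4P: zt; rewrite !inE /shift;
    case: t => t1 t2; rewrite !xpair_eqE /=; lia)) xW.
have [v0 [b [vb va]]] := component_range d4C (u := fun z => z.1 - z.2)
  (fun z t zt => ltac:(move/adjacent4P: zt; rewrite !inE /shift;
    case: t => t1 t2; rewrite !xpair_eqE /=; lia)) xW.
exists u0, v0, a, b; split; first by move=> z zK; apply/andP; split; [exact: ub | exact: vb].
rewrite (eq_big_seq (fun z => \sum_(d <- diagonals) (shift d z \notin K))%N); last first.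
  by move=> z zK; apply: eq_bigr => d _; rewrite (mem_component_class zK).
rewrite exchange_big /= !big_cons big_nil.
have e1 := @exits_dir K (1, 1) (fun z => z.1 - z.2) v0 b uK isT.
have e2 := @exits_dir K (-1, -1) (fun z => z.1 - z.2) v0 b uK isT.
have e3 := @exits_dir K (1, -1) (fun z => z.1 + z.2) u0 a uK isT.
have e4 := @exits_dir K (-1, 1) (fun z => z.1 + z.2) u0 a uK isT.
have {}e1 := e1 (fun z => ltac:(rewrite /shift /=; lia)) va.
have {}e2 := e2 (fun z => ltac:(rewrite /shift /=; lia)) va.
have {}e3 := e3 (fun z => ltac:(rewrite /shift /=; lia)) ua.
have {}e4 := e4 (fun z => ltac:(rewrite /shift /=; lia)) ua.
by rewrite addn0; apply: leq_trans (leq_add e1 (leq_add e2 (leq_add e3 e4))); lia.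
Qed.

Definition corners : seq pixel := [:: (0, 0); (1, 0); (0, 1); (1, 1)].

Definition whites (W : seq pixel) (b : pixel) : nat := (\sum_(c <- corners) (shift c b \in W))%N.

Definition bad (W : seq pixel) (b : pixel) : bool := (whites W b <= 1)%N.

(* The direction of the diagonal of a block starting at its corner [c]. *)
Definition across (c : pixel) : pixel := (1 - 2 * c.1, 1 - 2 * c.2).

Lemma diag_connected (W : seq pixel) x y z : x \in W -> y \in W -> z \in W ->
  Defs.adjacent d4 x y -> Defs.adjacent d4 y z -> z \in component d4 W x.
Proof.
move=> xW yW zW xy yz.
apply: (component_step d4C) yz => //; apply: (component_step d4C) xy => //.
exact: (component_self d4C).
Qed.

(* An exit from [C] through a block either ends in a black pixel of the block, or
   in another component, in which case the other two pixels are black. *)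
Lemma block_exits (W : seq pixel) (z : pixel) :
  (\sum_(c <- corners)
     (shift c z \in W) * (shift (across c) (shift c z)
        \notin component d4 W (shift c z))
   + bad W z + whites W z <= 4)%N.
Proof.

have S c e : shift e (shift c z) = shift (shift e c) z.
  by apply: pixel_eq => /=; lia.
have H (c e c' : pixel) : Defs.adjacent d4 c e -> Defs.adjacent d4 e c' ->
    [&& shift c z \in W, shift e z \in W & shift c' z \in W] ==>
    (shift c' z \in component d4 W (shift c z)).
  move=> a1 a2; apply/implyP => /and3P[h1 h2 h3].
  apply: (@diag_connected _ _ (shift e z)) => //.
    by move: a1; rewrite /Defs.adjacent /d4 /shift /=; lia.
  by move: a2; rewrite /Defs.adjacent /d4 /shift /=; lia.
rewrite /bad /whites !big_cons !big_nil /= !S.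
have -> : shift (across (0, 0)) (0, 0) = (1, 1) by [].
have -> : shift (across (1, 0)) (1, 0) = (0, 1) by [].
have -> : shift (across (0, 1)) (0, 1) = (1, 0) by [].
have -> : shift (across (1, 1)) (1, 1) = (0, 0) by [].

have h1 := H (0, 0) (1, 0) (1, 1) isT isT; have h2 := H (0, 0) (0, 1) (1, 1) isT isT.
have h3 := H (1, 1) (1, 0) (0, 0) isT isT; have h4 := H (1, 1) (0, 1) (0, 0) isT isT.
have h5 := H (1, 0) (0, 0) (0, 1) isT isT; have h6 := H (1, 0) (1, 1) (0, 1) isT isT.
have h7 := H (0, 1) (0, 0) (1, 0) isT isT; have h8 := H (0, 1) (1, 1) (1, 0) isT isT.
move: h1 h2 h3 h4 h5 h6 h7 h8; clear H S.
move: (_ \in component d4 W (shift (0, 0) z)) (_ \in component d4 W (shift (1, 0) z)).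
move: (_ \in component d4 W (shift (0, 1) z)) (_ \in component d4 W (shift (1, 1) z)).
move: (shift (0, 0) z \in W) (shift (1, 0) z \in W).
move: (shift (0, 1) z \in W) (shift (1, 1) z \in W).
by do 8!case.
Qed.

Lemma exits_sum (B W : seq pixel) : uniq B -> uniq W ->
  (forall c z, c \in corners -> z \in W -> shift (antipode c) z \in B) ->
  (\sum_(z <- W) exits W z + \sum_(b <- B) bad W b + 4 * size W <= 4 * size B)%N.
Proof.
move=> uB uW WB.
have H : (\sum_(b <- B) (\sum_(c <- corners)
     (shift c b \in W) * (shift (across c) (shift c b)
        \notin component d4 W (shift c b)) + bad W b + whites W b) <= \sum_(b <- B) 4)%N.
  by apply: leq_sum => b _; exact: block_exits.
move: H; rewrite !big_split /= exchange_big /= [X in (_ + X <= _)%N]exchange_big /=.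
rewrite [X in (_ <= X)%N]big_const_seq count_predT iter_addn_0.
have -> : (\sum_(c <- corners) \sum_(b <- B) (shift c b \in W) = 4 * size W)%N.
  rewrite (eq_big_seq (fun=> size W)); last first.
    move=> c cc; rewrite -sum1_size -(@sum_shift_mem B W c) //; last by move=> z; exact: WB.
    by apply: eq_bigr => b _; rewrite muln1.
  by rewrite !big_cons big_nil; lia.
apply: leq_trans; rewrite !leq_add2r.
rewrite [leqRHS](eq_big_seq (fun c => \sum_(z <- W)
    (shift (across c) z \notin component d4 W z))%N); last first.
  move=> c cc; apply: (@sum_shift_mem B W c (fun z =>
    (shift (across c) z \notin component d4 W z) : nat)) => // z; exact: WB.
rewrite [leqRHS]exchange_big /=. apply: leq_sum => z _.
rewrite /exits !big_cons !big_nil /=.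
have -> : across (0, 0) = (1, 1) by [].
have -> : across (1, 0) = (-1, 1) by [].
have -> : across (0, 1) = (1, -1) by [].
have -> : across (1, 1) = (-1, -1) by [].
do ![case: (_ \notin _)] => //.
Qed.

(** * Blocks of 8-components *)

Lemma size_sumset (K : seq pixel) (d : pixel) (v : pixel -> int) (v0 : int) (b : nat) :
  uniq K -> (d.1 != 0) || (d.2 != 0) -> (forall z, v (shift d z) = v z) ->
  (forall c : int, v0 <= c < v0 + b%:Z -> exists2 z, z \in K & v z = c) ->
  exists K' : seq pixel,
   [/\ uniq K', K' =i K ++ map (shift d) K & (size K + b <= size K')%N].
Proof.
move=> uK d0 vd vK; exists (K ++ [seq z <- map (shift d) K | z \notin K]); split.
- rewrite cat_uniq uK filter_uniq ?map_inj_uniq ?andbT //; last exact: shift_inj.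
  by apply/hasPn => z; rewrite mem_filter => /andP[].
- by move=> z; rewrite !mem_cat mem_filter; case: (z \in K).
rewrite size_cat leq_add2l; apply: leq_trans (exits_dir uK d0 vd vK) _.
by rewrite -big_mkcond /= sum1_count size_filter count_map.
Qed.

Lemma adjacent8P (x y : pixel) : Defs.adjacent d8 x y <->
  [&& y != x, `|y.1 - x.1| <= 1 & `|y.2 - x.2| <= 1].
Proof.
case: x y => [x1 x2] [y1 y2]; rewrite /Defs.adjacent /d8 /= xpair_eqE.
by split; lia.
Qed.

Definition block_rep (W : seq pixel) (b : pixel) : pixel :=
  head b [seq z <- [seq shift c b | c <- corners] | z \in W].

Definition rep_count (B W : seq pixel) (z : pixel) : nat :=
  (\sum_(b <- B) (block_rep W b == z))%N.

Lemma rep_count_sum (B W K : seq pixel) : uniq K ->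
  (\sum_(z <- K) rep_count B W z = \sum_(b <- B) (block_rep W b \in K))%N.
Proof.
move=> uK; rewrite exchange_big /=; apply: eq_bigr => b _.
rewrite -count_uniq_mem // -sum1_count [RHS]big_mkcond; apply: eq_bigr => z _.
by rewrite /= eq_sym; case: ifP.
Qed.

Lemma component8_blocks (B W : seq pixel) x : uniq W -> x \in W ->
  (forall c z, c \in corners -> z \in W -> shift (antipode c) z \in B) ->
  exists w h : nat, (size (component d8 W x) <= w * h)%N /\
   (size (component d8 W x) + w + h + 1 <= \sum_(z <- component d8 W x) rep_count B W z)%N.
Proof.
move=> uW xW WB; set K := component d8 W x; have uK : uniq K by exact: filter_uniq.
have [x0 [w [ub ua]]] := component_range d8C (u := fun z => z.1)
  (fun z t zt => ltac:(move/adjacent8P: zt; case: z t => z1 z2 [t1 t2] /=; lia)) xW.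
have [y0 [h [vb va]]] := component_range d8C (u := fun z => z.2)
  (fun z t zt => ltac:(move/adjacent8P: zt; case: z t => z1 z2 [t1 t2] /=; lia)) xW.
exists w, h; split.
  pose rect : seq pixel := [seq (x0 + i%:Z, y0 + j%:Z) | i <- iota 0 w, j <- iota 0 h].
  have -> : (w * h = size rect)%N by rewrite size_allpairs !size_iota.
  apply: uniq_leq_size => // -[z1 z2] zK; have /= := ub _ zK; have /= := vb _ zK => h1 h2.
  apply/allpairsP; exists (absz (z1 - x0), absz (z2 - y0)); rewrite !mem_iota.
  by split=> /=; [lia | lia | apply: pixel_eq; lia].
have [K1 [uK1 eK1 sK1]] := @size_sumset K (-1, 0) (fun z => z.2) y0 h uK isT
  (fun z => ltac:(rewrite /shift /=; lia)) va.
have [|K2 [uK2 eK2 sK2]] := @size_sumset K1 (0, -1) (fun z => z.1) (x0 - 1) w.+1 uK1 isT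
  (fun z => ltac:(rewrite /shift /=; lia)).
  move=> c cr; have [c0|c0] := eqVneq c (x0 - 1).
    have [|z zK zc] := ua (c + 1); first by have /andP := ub _ (component_self d8C xW); lia.
    exists (shift (-1, 0) z); first by rewrite eK1 mem_cat map_f ?orbT.
    by rewrite /shift /=; lia.
  have [|z zK zc] := ua c; first by lia.
  by exists z => //; rewrite eK1 mem_cat zK.
have : (size K2 <= count (fun b => block_rep W b \in K) B)%N.
  rewrite -size_filter; apply: uniq_leq_size => // b bK2.
  have [c cc bK] : exists2 c, c \in corners & shift c b \in K.
    move: bK2; rewrite eK2 mem_cat => /orP[|/mapP[b' + ->]]; rewrite eK1 mem_cat.
      case/orP=> [bK|/mapP[z zK ->]]; [exists (0, 0) | exists (1, 0)] => //.
        by rewrite (_ : shift _ b = b) //; case: (b) => *; apply: pixel_eq => /=; lia.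
      by rewrite (_ : shift _ _ = z) //; case: (z) => *; apply: pixel_eq => /=; lia.
    case/orP=> [bK|/mapP[z zK ->]]; [exists (0, 1) | exists (1, 1)] => //.
      by rewrite (_ : shift _ _ = b') //; case: (b') => *; apply: pixel_eq => /=; lia.
    by rewrite (_ : shift _ _ = z) //; case: (z) => *; apply: pixel_eq => /=; lia.
  have bW := component_sub bK.
  rewrite mem_filter; apply/andP; split.
    have : block_rep W b \in [seq z <- [seq shift c b | c <- corners] | z \in W].
      rewrite /block_rep; case E : [seq _ <- _ | _] => [|z s]; last exact: mem_head.
      have : shift c b \in [seq z <- [seq shift c b | c <- corners] | z \in W].
        by rewrite mem_filter bW; apply/mapP; exists c.
      by rewrite E.
    rewrite mem_filter => /andP[rW /mapP[e ec re]].
    have [<-//|ne] := eqVneq (shift c b) (block_rep W b).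
    apply: (component_step d8C) bK rW _; apply/adjacent8P; rewrite eq_sym ne re /=.
    move: cc ec; rewrite !inE => /or4P[]/eqP-> /or4P[]/eqP-> /=; lia.
  rewrite (_ : b = shift (antipode c) (shift c b)); last by rewrite shiftK.
  exact: WB.
have -> : (\sum_(z <- K) rep_count B W z = count (fun b => block_rep W b \in K) B)%N.
  rewrite rep_count_sum // -sum1_count [RHS]big_mkcond; apply: eq_bigr => b _.
  by case: ifP.
lia.
Qed.

(** * The obstruction to optimal tilings *)

Definition perp (d : pixel) : pixel := (- d.2, d.1).

Definition axes : seq pixel := [:: (1, 0); (-1, 0); (0, 1); (0, -1)].

Definition normals (e : pixel) : seq pixel := [:: perp e; antipode (perp e)].

Definition tight_at (W : pred pixel) (z : pixel) : Prop :=
  forall e f, e \in axes -> f \in normals e ->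
    (2 <= W z + W (shift e z) + W (shift f z) + W (shift f (shift e z)))%N.

Definition box_at (W : pred pixel) (P : nat) (z : pixel) : Prop :=
  W z -> exists (u0 v0 : int) (a b : nat),
    [/\ (a = P /\ b = P.+1) \/ (a = P.+1 /\ b = P), inbox u0 v0 a b z,
        forall y, inbox u0 v0 a b y -> W y
      & forall y d, d \in axes -> inbox u0 v0 a b y ->
          W (shift d y) = inbox u0 v0 a b (shift d y)].

Definition pointed (W : pred pixel) (z d : pixel) : bool :=
  [&& ~~ W (shift d z), ~~ W (shift (perp d) z) & ~~ W (shift (antipode (perp d)) z)].

Definition used_at (W : pred pixel) (z : pixel) : Prop :=
  forall d, d \in axes -> W z -> pointed W z d -> ~~ W (shift d (shift d z)).

Definition near (R : nat) (z0 z : pixel) : bool :=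
  (`|z.1 - z0.1| <= R%:Z) && (`|z.2 - z0.2| <= R%:Z).

Definition perfect (W : pred pixel) (P : nat) (z0 : pixel) (R : nat) : Prop :=
  forall z, near R z0 z -> [/\ tight_at W z, box_at W P z & used_at W z].

Definition regular (W : pred pixel) (P : nat) (z0 : pixel) (R : nat) : Prop :=
  forall z, near R z0 z -> tight_at W z /\ box_at W P z.

Definition reflect (s t : int) (c z : pixel) : pixel := (c.1 + s * z.1, c.2 + t * z.2).

Lemma reflect_shift s t c d z :
  reflect s t c (shift d z) = shift (s * d.1, t * d.2) (reflect s t c z).
Proof. by apply: pixel_eq => /=; ring. Qed.

Lemma perfect_reflect (W : pred pixel) P c R s t : s \in [:: 1; -1] -> t \in [:: 1; -1] ->
  perfect W P c R -> perfect (fun z => W (reflect s t c z)) P (0, 0) R.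
Proof.
move=> hs ht pW z zR.
have [|tW bW uW] := pW (reflect s t c z).
  by move: zR hs ht; rewrite /near /reflect !inE /= => zR /orP[]/eqP-> /orP[]/eqP->; lia.
have ax (d : pixel) : d \in axes -> (s * d.1, t * d.2) \in axes.
  by move: hs ht; rewrite !inE => /orP[]/eqP-> /orP[]/eqP-> /or4P[]/eqP->.
have nm (e f : pixel) : e \in axes -> f \in normals e ->
    (s * f.1, t * f.2) \in normals (s * e.1, t * e.2).
  by move: hs ht; rewrite !inE => /orP[]/eqP-> /orP[]/eqP-> /or4P[]/eqP-> /orP[]/eqP->.
split.
- by move=> e f ea fe; rewrite !reflect_shift; apply: tW; [exact: ax | exact: nm].
- move=> /bW [u0 [v0 [a [b [ab zb bb nb]]]]].
  have tr u1 v1 a1 b1 : ((a1 = P /\ b1 = P.+1) \/ (a1 = P.+1 /\ b1 = P)) ->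
     (forall y, inbox u1 v1 a1 b1 y = inbox u0 v0 a b (reflect s t c y)) ->
     exists u0 v0 a b,
    [/\ (a = P /\ b = P.+1) \/ (a = P.+1 /\ b = P), inbox u0 v0 a b z,
        forall y, inbox u0 v0 a b y -> W (reflect s t c y)
      & forall y d, d \in axes -> inbox u0 v0 a b y ->
          W (reflect s t c (shift d y)) = inbox u0 v0 a b (shift d y)].
    move=> ab1 e1; exists u1, v1, a1, b1; split=> //.
    + by rewrite e1.
    + by move=> y; rewrite e1; exact: bb.
    + by move=> y d /ax da; rewrite !e1 !reflect_shift; exact: nb.
  move: hs ht; rewrite !inE => /orP[]/eqP hs /orP[]/eqP ht; subst s t.
  + apply: (tr (u0 - c.1 - c.2) (v0 - c.1 + c.2) a b) => // y.
    by rewrite /inbox /reflect /=; lia.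
  + apply: (tr (v0 - c.1 + c.2) (u0 - c.1 - c.2) b a); first by lia.
    by move=> y; rewrite /inbox /reflect /=; lia.
  + apply: (tr (c.1 - c.2 - v0 - b%:Z + 1) (c.1 + c.2 - u0 - a%:Z + 1) b a); first by lia.
    by move=> y; rewrite /inbox /reflect /=; lia.
  + apply: (tr (c.1 + c.2 - u0 - a%:Z + 1) (c.1 - c.2 - v0 - b%:Z + 1) a b) => // y.
    by rewrite /inbox /reflect /=; lia.
- move=> d da Wz; rewrite /pointed !reflect_shift => pz.
  apply: uW => //; first exact: ax.
  move: pz; move: da hs ht; rewrite /pointed !inE.
  by move=> /or4P[]/eqP-> /orP[]/eqP-> /orP[]/eqP-> /=; rewrite ?(mulN1r, mul1r, mulr0, oppr0, opprK) => /and3P[-> -> ->].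
Qed.

(* Hypotheses on colours only slow [lia] down. *)
Ltac plia :=
  repeat match goal with
  | W : pred pixel |- _ => match goal with H : context [W] |- _ => clear H end
  end; lia.

Lemma no_perfect_box (W : pred pixel) (P R a b : nat) :
  (2 <= P)%N -> (P + 4 <= R)%N -> (a = P /\ b = P.+1) \/ (a = P.+1 /\ b = P) ->
  ~~ odd a -> odd b -> perfect W P (0, 0) R ->
  (forall y, inbox 0 0 a b y -> W y) ->
  (forall y d, d \in axes -> inbox 0 0 a b y -> W (shift d y) = inbox 0 0 a b (shift d y)) ->
  False.
Proof.
move=> P2 PR ab ea ob pW CW Cn.
pose h : nat := b./2; have bh : b = h.*2.+1 by rewrite /h; lia.
have h1 : (1 <= h)%N by lia.
have eqW (x y x' y' : int) : x = x' -> y = y' -> W (x, y) = W (x', y') by move=> -> ->.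
have nbr (x y dx dy x' y' : int) : (dx, dy) \in axes -> inbox 0 0 a b (x, y) ->
    x' = x + dx -> y' = y + dy -> ~~ inbox 0 0 a b (x', y') -> W (x', y') = false.
  by move=> da xyb -> -> ni; rewrite -[(_, _)]/(shift (dx, dy) (x, y)) Cn //; apply: negbTE.
have tight (x y : int) : near R (0, 0) (x, y) ->
    (2 <= W (x, y) + W (x + 1, y)%R + W (x, y + 1)%R + W (x + 1, y + 1)%R)%N.
  move=> /pW [tW _ _]; have := tW (1, 0) (0, 1) isT isT; rewrite /shift /=.
  by rewrite !addr0.
have black (i : nat) (x y : int) : (i <= h.+1)%N -> x = i%:Z - 1 -> y = - i%:Z -> W (x, y) = false.
  move=> ih xi yi; have [le|gt] := leqP i h.
    by apply: (@nbr i%:Z (- i%:Z) (-1) 0); rewrite /inbox //=; plia.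
  by apply: (@nbr (i%:Z - 1) (1 - i%:Z) 0 (-1)); rewrite /inbox //=; plia.
have used (x y dx dy : int) : near R (0, 0) (x, y) -> (dx, dy) \in axes -> W (x, y) ->
   W (x + dx, y + dy) = false -> W (x - dy, y + dx) = false -> W (x + dy, y - dx) = false ->
   W (x + dx + dx, y + dy + dy) = false.
  move=> /pW [_ _ uW] da Wxy f1 f2 f3; apply/negbTE.
  apply: (uW (dx, dy) da Wxy); rewrite /pointed /shift /= f1 f2 opprK f3.
  by [].
have Wdiag (i : nat) (x y : int) : (i <= h)%N -> x = i%:Z -> y = - i%:Z -> W (x, y).
  by move=> ih -> ->; apply: CW; rewrite /inbox /=; plia.
(* The two pointed corners of the long side are used. *)
have r1 : W (-2, 0) = false.
  have := used 0 0 (-1) 0; rewrite /near /= => u; apply: u; rewrite ?inE //.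
  - by apply: (Wdiag 0%N).
  - by apply: (black 0%N).
  - by apply: (black 1%N).
  - by apply: (@nbr 0 0 0 1); rewrite /inbox //=; plia.
have r2 : W (h%:Z, - h%:Z - 2) = false.
  have := used h%:Z (- h%:Z) 0 (-1); rewrite /near /= => u.
  have -> : W (h%:Z, - h%:Z - 2) = W (h%:Z + 0 + 0, - h%:Z + -1 + -1) by apply: eqW; plia.
  apply: u; rewrite ?inE //.
  - by plia.
  - by apply: (Wdiag h).
  - by apply: (black h.+1) => //; plia.
  - by apply: (@nbr h%:Z (- h%:Z) 1 0); rewrite /inbox //=; plia.
  - by apply: (black h); plia.
have white2 (i : nat) (x y : int) : (i <= h)%N -> x = i%:Z - 1 -> y = - i%:Z - 1 -> W (x, y).
  move=> ih xi yi; have nr : near R (0, 0) (x, y) by rewrite /near /=; plia.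
  have k1 : W (x, y + 1) = false by apply: (black i); plia.
  have k2 : W (x + 1, y) = false by apply: (black i.+1); plia.
  by have := tight x y nr; rewrite k1 k2; case: (W (x, y)); case: (W (x + 1, y + 1)).
(* A black pixel on the next line would give an unused pointed corner. *)
have white3 (i : nat) (x y : int) : (1 <= i <= h)%N -> x = i%:Z - 2 -> y = - i%:Z - 1 -> W (x, y).
  move=> ih xi yi; apply/negPn/negP => /negbTE nW.
  have := used x (y + 1) 1 0; rewrite /near /= => u.
  suff k : W (x + 1 + 1, y + 1 + 0 + 0) = false.
    have k' : W (x + 1 + 1, y + 1 + 0 + 0) by apply: (Wdiag i); plia.
    by rewrite k in k'.
  apply: u; rewrite ?inE //.
  - by plia.
  - by apply: (white2 i.-1); plia.
  - by apply: (black i); plia.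
  - by apply: (black i.-1); plia.
  - have <- : W (x, y) = W (x + 0, y + 1 - 1) by apply: eqW; plia.
    exact: nW.
have [|_ bM _] := pW (-1, -1); first by rewrite /near /=; plia.
have [|u1 [v1 [a1 [b1 [ab1 M0 _ Mn]]]]] := bM; first by apply: (white2 0%N).
have Mnbr (x y dx dy x' y' : int) : (dx, dy) \in axes -> inbox u1 v1 a1 b1 (x, y) ->
    x' = x + dx -> y' = y + dy -> W (x', y') = inbox u1 v1 a1 b1 (x', y').
  by move=> da xyb -> ->; rewrite -[(_, _)]/(shift (dx, dy) (x, y)) Mn.
have Mi (i : nat) (x y : int) : (i <= h)%N -> x = i%:Z - 1 -> y = - i%:Z - 1 -> inbox u1 v1 a1 b1 (x, y).
  elim: i x y => [|i IH] x y ih xi yi.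
    by have [-> ->] : x = -1 /\ y = -1 by plia.
  have m1 := IH (i%:Z - 1) (- i%:Z - 1) (ltnW ih) erefl erefl.
  have m2 : inbox u1 v1 a1 b1 (i%:Z - 1, - i%:Z - 2).
    have <- : W (i%:Z - 1, - i%:Z - 2) = inbox u1 v1 a1 b1 (i%:Z - 1, - i%:Z - 2).
      by apply: (@Mnbr _ _ 0 (-1) _ _ isT m1); plia.
    by apply: (white3 i.+1); plia.
  have <- : W (x, y) = inbox u1 v1 a1 b1 (x, y) by apply: (@Mnbr _ _ 1 0 _ _ isT m2); plia.
  by apply: (white2 i.+1); plia.
have Mh := Mi h (h%:Z - 1) (- h%:Z - 1) (leqnn h) erefl erefl.
have e1 : inbox u1 v1 a1 b1 (0, -1) = false.
  have <- : W (0, -1) = inbox u1 v1 a1 b1 (0, -1) by apply: (@Mnbr _ _ 1 0 _ _ isT M0).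
  by apply: (black 1%N).
move: (M0) (Mh) (e1); rewrite /inbox /= => M0' Mh' e1'.
have v1neg : v1 <= -1.
  rewrite leNgt; apply/negP => v1pos.
  have k1 : W (-2, -1) = false.
    have -> : W (-2, -1) = inbox u1 v1 a1 b1 (-2, -1) by apply: (@Mnbr _ _ (-1) 0 _ _ isT M0).
    by rewrite /inbox /=; plia.
  have k2 : W (-1, 0) = false by apply: (black 0%N).
  have nr : near R (0, 0) (-2, -1) by rewrite /near /=; plia.
  by have := tight _ _ nr; rewrite k1 r1 k2; case: (W _).
have v1top : v1 + b1%:Z >= h%:Z + h%:Z + 2.
  rewrite leNgt; apply/negP => v1low.
  have k1 : W (h%:Z - 1, - h%:Z - 2) = false.
    have -> : W (h%:Z - 1, - h%:Z - 2) = inbox u1 v1 a1 b1 (h%:Z - 1, - h%:Z - 2).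
      by apply: (@Mnbr _ _ 0 (-1) _ _ isT Mh); plia.
    by rewrite /inbox /=; plia.
  have k2 : W (h%:Z - 1 + 1, - h%:Z - 2 + 1) = false by apply: (black h.+1) => //; plia.
  have k3 : W (h%:Z - 1 + 1, - h%:Z - 2) = false.
    have <- : W (h%:Z, - h%:Z - 2) = W (h%:Z - 1 + 1, - h%:Z - 2) by apply: eqW; plia.
    exact: r2.
  have nr : near R (0, 0) (h%:Z - 1, - h%:Z - 2) by rewrite /near /=; plia.
  by have := tight _ _ nr; rewrite k1 k2 k3; case: (W _).
plia.
Qed.

Lemma near_sub (R R' : nat) (z0 z1 z : pixel) : near R z1 z ->
  `|z1.1 - z0.1| + R%:Z <= R'%:Z -> `|z1.2 - z0.2| + R%:Z <= R'%:Z -> near R' z0 z.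
Proof. rewrite /near; lia. Qed.

Lemma not_perfect (W : pred pixel) (P : nat) (z0 : pixel) : (2 <= P)%N -> W z0 ->
  ~ perfect W P z0 (3 * P + 10).
Proof.
move=> P2 Wz pW.
have [|_ bz _] := pW z0; first by rewrite /near !subrr normr0; lia.
have [u0 [v0 [a [b [ab zb CW Cn]]]]] := bz Wz.
have final (s t : int) (c : pixel) (a' b' : nat) :
    s \in [:: 1; -1] -> t \in [:: 1; -1] ->
    `|c.1 - z0.1| + (P + 4)%N%:Z <= (3 * P + 10)%N%:Z ->
    `|c.2 - z0.2| + (P + 4)%N%:Z <= (3 * P + 10)%N%:Z ->
    (a' = P /\ b' = P.+1) \/ (a' = P.+1 /\ b' = P) -> ~~ odd a' -> odd b' ->
    (forall y, inbox 0 0 a' b' y = inbox u0 v0 a b (reflect s t c y)) -> False.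
  move=> hs ht c1 c2 ab' ea ob e.
  have pc : perfect W P c (P + 4) by move=> z zn; apply: pW; exact: near_sub zn c1 c2.
  apply: (no_perfect_box P2 (leqnn _) ab' ea ob (perfect_reflect hs ht pc)).
    by move=> y; rewrite e; exact: CW.
  move=> y d da; rewrite !e reflect_shift; apply: Cn.
  by move: da hs ht; rewrite !inE => /or4P[]/eqP-> /orP[]/eqP-> /orP[]/eqP->.
move: zb; rewrite /inbox => zb.
have [ea|oa] := boolP (odd a); have [es|os] := boolP (odd (absz (u0 + v0))).
- pose c : pixel := (((u0 + a%:Z - 1 + v0 + b%:Z - 1) %/ 2)%Z, ((u0 + a%:Z - 1 - v0 - b%:Z + 1) %/ 2)%Z).
  apply: (final (-1) 1 c b a); rewrite /c //=; try lia.
  by move=> y; rewrite /inbox /reflect /=; lia.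
- pose c : pixel := (((u0 + v0) %/ 2)%Z, ((u0 - v0) %/ 2)%Z).
  apply: (final 1 (-1) c b a); rewrite /c //=; try lia.
  by move=> y; rewrite /inbox /reflect /=; lia.
- pose c : pixel := (((u0 + a%:Z - 1 + v0 + b%:Z - 1) %/ 2)%Z, ((u0 + a%:Z - 1 - v0 - b%:Z + 1) %/ 2)%Z).
  apply: (final (-1) (-1) c a b); rewrite /c //=; try lia.
  by move=> y; rewrite /inbox /reflect /=; lia.
- pose c : pixel := (((u0 + v0) %/ 2)%Z, ((u0 - v0) %/ 2)%Z).
  apply: (final 1 1 c a b); rewrite /c //=; try lia.
  by move=> y; rewrite /inbox /reflect /=; lia.
Qed.

Definition flat (W : pred pixel) (z e f : pixel) : bool :=
  [&& ~~ W (shift f z), W (shift e z), ~~ W (shift f (shift e z))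
    & ~~ W (shift (antipode e) z)].

Definition beside (z e f : pixel) : pixel := shift f (shift (antipode e) z).

Lemma shiftC (d e z : pixel) : shift d (shift e z) = shift e (shift d z).
Proof. by rewrite /shift /= addrAC (addrAC z.2). Qed.

Lemma antipodeK : involutive antipode.
Proof. by case=> x y; rewrite /antipode /= !opprK. Qed.

Lemma near_refl R z : near R z z.
Proof. by rewrite /near !subrr normr0. Qed.

Lemma near_step R (z0 z d : pixel) : d \in axes -> near R z0 z -> near R.+1 z0 (shift d z).
Proof. by rewrite /near /shift !inE => /or4P[]/eqP-> /=; lia. Qed.

(* An end of a flat side of length two faces a pointed corner of a third component
   whose tip is closed by the black edge next to the flat side. *)
Lemma flat_used (W : pred pixel) (P : nat) (z e f : pixel) :
  e \in axes -> f \in normals e -> regular W P z 3 -> W z -> flat W z e f ->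
  [/\ W (beside z e f), pointed W (beside z e f) e
    & ~~ W (shift e (shift e (beside z e f)))].
Proof.
move=> ea fe pW Wz /and4P[b1 w1 b2 b3].
have na : antipode e \in axes by move: ea; rewrite !inE => /or4P[]/eqP->.
have fa : f \in axes by move: ea fe; rewrite !inE => /or4P[]/eqP-> /orP[]/eqP->.
have nf : antipode f \in axes by move: fa; rewrite !inE => /or4P[]/eqP->.
have step1 d : d \in axes -> near 2 z (shift d z) by move=> da; exact: near_step da (near_refl _ _).
have sub (y : pixel) : near 2 z y -> near 3 z y by rewrite /near; clear; lia.
have [tq _] := pW _ (sub _ (step1 f fa)).
have [tm _] := pW _ (sub _ (step1 _ na)).
have := tq e f ea fe; rewrite (shiftC e f) (negbTE b1) (negbTE b2) => t1.
have w2 : W (shift f (shift f z)) by move: t1; case: (W _) => //; case: (W _).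
have w3 : W (shift f (shift f (shift e z))) by move: t1; rewrite w2; case: (W _).
have := tm e f ea fe; rewrite shiftNK Wz (negbTE b3) (negbTE b1) => t2.
have w4 : W (beside z e f) by move: t2; rewrite /beside; case: (W _).
have b4 : ~~ W (shift f (beside z e f)).
  apply/negP => w5.
  have [_ bx] := pW _ (near_step fa (step1 f fa)).
  have [u0 [v0 [a [b [_ i1 CW Cn]]]]] := bx w2.
  have i2 : inbox u0 v0 a b (shift f (beside z e f)).
    have k : shift (antipode e) (shift f (shift f z)) = shift f (beside z e f).
      by rewrite /beside !(shiftC (antipode e)).
    by rewrite -k -Cn // k.
  have i3 : inbox u0 v0 a b (beside z e f).
    by rewrite -(shiftK f (beside z e f)) -Cn // shiftK.
  have i4 : inbox u0 v0 a b (shift e (shift f (shift f z))).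
    by rewrite -Cn // !(shiftC e).
  apply/negP: b1; rewrite negbK; apply: CW.
  move: i1 i2 i3 i4; rewrite /inbox /beside /shift /=.
  clear - ea fe; move: ea fe; rewrite !inE.
  by move=> /or4P[]/eqP-> /orP[]/eqP-> /=; lia.
have be : shift e (beside z e f) = shift f z by rewrite /beside (shiftC e f) shiftNK.
have bf : shift (antipode f) (beside z e f) = shift (antipode e) z by rewrite /beside shiftK.
split=> //; last by rewrite be (shiftC e f).
rewrite /pointed be b1 /=.
move: fe; rewrite !inE => /orP[]/eqP ef; rewrite -ef.
  by rewrite bf b4 b3.
have -> : perp e = antipode f by rewrite ef antipodeK.
by rewrite bf b3 b4.
Qed.

Lemma sum_count (K : seq pixel) (p : pred pixel) : (\sum_(z <- K) p z = count p K)%N.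
Proof. by rewrite -sum1_count [RHS]big_mkcond; apply: eq_bigr => z _; case: (p z). Qed.

Lemma sum_pred_le (K : seq pixel) (p : pred pixel) (c : bool) : uniq K ->
  (forall z, z \in K -> p z -> c) ->
  (forall z w, z \in K -> w \in K -> p z -> p w -> z = w) -> (\sum_(z <- K) p z <= c)%N.
Proof.
move=> uK pc pI; rewrite sum_count -size_filter.
case E : [seq z <- K | p z] => [//|x s].
have : x \in [seq z <- K | p z] by rewrite E mem_head.
rewrite mem_filter => /andP[px xK]; rewrite (pc x) //.
have := filter_uniq p uK; rewrite E; case: s E => [//|y s] E /= /andP[+ _].
have : y \in [seq z <- K | p z] by rewrite E !inE eqxx orbT.
by rewrite mem_filter => /andP[py yK]; rewrite (pI x y) // mem_head.
Qed.

Lemma sum_pred_ge (K : seq pixel) (p : pred pixel) (c : bool) :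
  (c -> exists2 z, z \in K & p z) -> (c <= \sum_(z <- K) p z)%N.
Proof.
by case: c => // /(_ isT) [z zK pz]; rewrite sum_count -has_count; apply/hasP; exists z.
Qed.

Definition optimal (W : seq pixel) (P : nat) (x : pixel) : Prop :=
  exists (u0 v0 : int) (a b : nat),
    ((a = P /\ b = P.+1) \/ (a = P.+1 /\ b = P)) /\
    component d4 W x =i inbox u0 v0 a b.

Lemma axes_adjacent d z : d \in axes -> Defs.adjacent d4 z (shift d z).
Proof. by move=> da; apply/adjacent4P; move: da; rewrite !inE => /or4P[]/eqP->; rewrite eqxx ?orbT. Qed.

Lemma inbox_nbr (W : seq pixel) x u0 v0 a b y d : component d4 W x =i inbox u0 v0 a b ->
  d \in axes -> inbox u0 v0 a b y -> (shift d y \in W) = inbox u0 v0 a b (shift d y).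
Proof.
move=> e da yb; rewrite -[inbox u0 v0 a b _]/(_ \in inbox u0 v0 a b) -e.
apply/idP/idP; last exact: component_sub.
move=> dW; apply: (component_step d4C) dW (axes_adjacent _ da).
by rewrite e.
Qed.

Lemma optimal_box (W : seq pixel) P x : x \in W -> optimal W P x -> box_at (mem W) P x.
Proof.
move=> xW [u0 [v0 [a [b [ab e]]]]] _; exists u0, v0, a, b; split=> //.
- by have := component_self d4C xW; rewrite e.
- move=> y yb; have : y \in component d4 W x by rewrite e.
  exact: component_sub.
- by move=> y d da yb; exact: inbox_nbr e da yb.
Qed.

Lemma optimal_class (W : seq pixel) P x y : y \in component d4 W x ->
  optimal W P x -> optimal W P y.
Proof.
move=> yx [u0 [v0 [a [b [ab e]]]]]; exists u0, v0, a, b; split=> // z.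
by rewrite (mem_component_class yx) e.
Qed.

Lemma class_sym (W : seq pixel) x y : y \in component d4 W x -> x \in component d4 W y.
Proof.
by move=> /(mem_component d4C) /(connected_sym d4C) yx; apply/(mem_component d4C).
Qed.

Definition pointed_count (W : seq pixel) (z : pixel) : nat :=
  (\sum_(d <- axes) pointed (mem W) z d)%N.

Definition flat_count (W : seq pixel) (z : pixel) : nat :=
  (\sum_(e <- axes) \sum_(f <- normals e) flat (mem W) z e f)%N.

Lemma inbox_shift u0 v0 a b (d z : pixel) : inbox u0 v0 a b (shift d z) =
  (u0 <= z.1 + z.2 + (d.1 + d.2) < u0 + a%:Z) && (v0 <= z.1 - z.2 + (d.1 - d.2) < v0 + b%:Z).
Proof. by rewrite /inbox /shift /= addrACA opprD [z.1 + _ + _]addrACA. Qed.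

Definition evenz (n : int) : bool := (n %% 2)%Z == 0.

Lemma optimal_pointed (W : seq pixel) (P : nat) x : (2 <= P)%N -> uniq W ->
  optimal W P x -> (\sum_(z <- component d4 W x) pointed_count W z <= 2)%N.
Proof.
move=> P2 uW [u0 [v0 [a [b [ab eK]]]]]; set K := component d4 W x in eK *.
have uK : uniq K by exact: filter_uniq.
have pt d (u1 v1 : int) : d \in axes ->
    (forall z, inbox u0 v0 a b z -> pointed (inbox u0 v0 a b) z d ->
       z.1 + z.2 = u1 /\ z.1 - z.2 = v1) ->
    (\sum_(z <- K) pointed (mem W) z d <= evenz (u1 + v1)%R)%N.
  move=> da h1.
  have pE z : z \in K -> pointed (mem W) z d = pointed (inbox u0 v0 a b) z d.
    rewrite eK => zK; rewrite /pointed /= !(inbox_nbr eK) //.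
      by move: da; rewrite !inE => /or4P[]/eqP->.
    by move: da; rewrite !inE => /or4P[]/eqP->.
  rewrite (eq_big_seq (fun z => pointed (inbox u0 v0 a b) z d : nat)); last first.
    by move=> z zK; rewrite pE.
  apply: sum_pred_le => //.
    by move=> z; rewrite eK => zb /(h1 z zb) []; clear; rewrite /evenz; lia.
  move=> z w; rewrite !eK => zb wb /(h1 z zb) + /(h1 w wb); clear.
  by case: z w => [z1 z2] [w1 w2] /= *; apply: pixel_eq; lia.
have a2 : (2 <= a)%N by clear -ab P2; lia.
have b2 : (2 <= b)%N by clear -ab P2; lia.
have cW : (\sum_(z <- K) pointed (mem W) z (-1, 0)%R <= evenz (u0 + v0)%R)%N.
  apply: pt => // z; clear -a2 b2; rewrite /pointed !inbox_shift /inbox /=.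
  by move: (z.1 + z.2) (z.1 - z.2) => u v; lia.
have cE : (\sum_(z <- K) pointed (mem W) z (1, 0)%R <=
    evenz (u0 + a%:Z - 1 + (v0 + b%:Z - 1))%R)%N.
  apply: pt => // z; clear -a2 b2; rewrite /pointed !inbox_shift /inbox /=.
  by move: (z.1 + z.2) (z.1 - z.2) => u v; lia.
have cN : (\sum_(z <- K) pointed (mem W) z (0, 1)%R <= evenz (u0 + a%:Z - 1 + v0)%R)%N.
  apply: pt => // z; clear -a2 b2; rewrite /pointed !inbox_shift /inbox /=.
  by move: (z.1 + z.2) (z.1 - z.2) => u v; lia.
have cS : (\sum_(z <- K) pointed (mem W) z (0, -1)%R <= evenz (u0 + (v0 + b%:Z - 1))%R)%N.
  apply: pt => // z; clear -a2 b2; rewrite /pointed !inbox_shift /inbox /=.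
  by move: (z.1 + z.2) (z.1 - z.2) => u v; lia.
rewrite /pointed_count exchange_big /= !big_cons big_nil addn0.
apply: leq_trans (leq_add cE (leq_add cW (leq_add cN cS))) _.
by clear -ab; rewrite /evenz; lia.
Qed.

Lemma optimal_flat (W : seq pixel) (P : nat) x : (2 <= P)%N ->
  optimal W P x -> (4 <= \sum_(z <- component d4 W x) flat_count W z)%N.
Proof.
move=> P2 [u0 [v0 [a [b [ab eK]]]]]; set K := component d4 W x in eK *.
have a2 : (2 <= a)%N by clear -ab P2; lia.
have b2 : (2 <= b)%N by clear -ab P2; lia.
have fl (e f : pixel) (c : bool) (u v : int) : e \in axes -> f \in axes ->
    (c -> evenz (u + v)) ->
    (forall z : pixel, z.1 + z.2 = u -> z.1 - z.2 = v ->
       inbox u0 v0 a b z && flat (inbox u0 v0 a b) z e f) ->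
    (c <= \sum_(z <- K) flat (mem W) z e f)%N.
  move=> ea fa ce h; apply: sum_pred_ge => /ce uv.
  have /andP[] := h (((u + v) %/ 2)%Z, ((u - v) %/ 2)%Z)
    (ltac:(move: uv; clear; rewrite /evenz /=; lia)) (ltac:(move: uv; clear; rewrite /evenz /=; lia)).
  set z := (_, _) => zb fz; exists z; first by rewrite eK.
  move: fz; rewrite /flat /= => /and4P[h1 h2 h3 h4].
  rewrite !(inbox_nbr eK) // ?h1 ?h2 ?h3 ?h4 //.
  by move: ea; rewrite !inE => /or4P[]/eqP->.
have fW e : e \in [:: (0, 1); (0, -1)] ->
    (~~ evenz (u0 + v0) <= \sum_(z <- K) flat (mem W) z e (-1, 0)%R)%N.
  rewrite !inE => /orP[]/eqP->.
    apply: (@fl _ _ _ u0 (v0 + 1)) => //; first by clear; rewrite /evenz; lia.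
    by move=> z e1 e2; rewrite /flat /inbox /shift /=; clear -a2 b2 e1 e2; lia.
  apply: (@fl _ _ _ (u0 + 1) v0) => //; first by clear; rewrite /evenz; lia.
  by move=> z e1 e2; rewrite /flat /inbox /shift /=; clear -a2 b2 e1 e2; lia.
have fE e : e \in [:: (0, 1); (0, -1)] ->
    (~~ evenz (u0 + a%:Z - 1 + (v0 + b%:Z - 1))%R <= \sum_(z <- K) flat (mem W) z e (1, 0)%R)%N.
  rewrite !inE => /orP[]/eqP->.
    apply: (@fl _ _ _ (u0 + a%:Z - 2) (v0 + b%:Z - 1)) => //; first by clear; rewrite /evenz; lia.
    by move=> z e1 e2; rewrite /flat /inbox /shift /=; clear -a2 b2 e1 e2; lia.
  apply: (@fl _ _ _ (u0 + a%:Z - 1) (v0 + b%:Z - 2)) => //; first by clear; rewrite /evenz; lia.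
  by move=> z e1 e2; rewrite /flat /inbox /shift /=; clear -a2 b2 e1 e2; lia.
have fN e : e \in [:: (1, 0); (-1, 0)] ->
    (~~ evenz (u0 + a%:Z - 1 + v0)%R <= \sum_(z <- K) flat (mem W) z e (0, 1)%R)%N.
  rewrite !inE => /orP[]/eqP->.
    apply: (@fl _ _ _ (u0 + a%:Z - 2) v0) => //; first by clear; rewrite /evenz; lia.
    by move=> z e1 e2; rewrite /flat /inbox /shift /=; clear -a2 b2 e1 e2; lia.
  apply: (@fl _ _ _ (u0 + a%:Z - 1) (v0 + 1)) => //; first by clear; rewrite /evenz; lia.
  by move=> z e1 e2; rewrite /flat /inbox /shift /=; clear -a2 b2 e1 e2; lia.
have fS e : e \in [:: (1, 0); (-1, 0)] ->
    (~~ evenz (u0 + (v0 + b%:Z - 1))%R <= \sum_(z <- K) flat (mem W) z e (0, -1)%R)%N.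
  rewrite !inE => /orP[]/eqP->.
    apply: (@fl _ _ _ u0 (v0 + b%:Z - 2)) => //; first by clear; rewrite /evenz; lia.
    by move=> z e1 e2; rewrite /flat /inbox /shift /=; clear -a2 b2 e1 e2; lia.
  apply: (@fl _ _ _ (u0 + 1) (v0 + b%:Z - 1)) => //; first by clear; rewrite /evenz; lia.
  by move=> z e1 e2; rewrite /flat /inbox /shift /=; clear -a2 b2 e1 e2; lia.
rewrite /flat_count exchange_big /= !big_cons big_nil addn0.
do ![rewrite exchange_big /= !big_cons big_nil addn0].
have n1 : perp (1, 0) = (0, 1) by [].
have n2 : antipode (perp (1, 0)) = (0, -1) by [].
have n3 : perp (-1, 0) = (0, -1) by [].
have n4 : antipode (perp (-1, 0)) = (0, 1) by [].
have n5 : perp (0, 1) = (-1, 0) by [].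
have n6 : antipode (perp (0, 1)) = (1, 0) by [].
have n7 : perp (0, -1) = (1, 0) by [].
have n8 : antipode (perp (0, -1)) = (-1, 0) by [].
rewrite n2 n1 n4 n3 n6 n5 n8 n7.
apply: leq_trans (leq_add (leq_add (fN _ _) (fS _ _)) (leq_add (leq_add (fS _ _) (fN _ _))
  (leq_add (leq_add (fW _ _) (fE _ _)) (leq_add (fE _ _) (fW _ _))))); rewrite ?inE //.
by clear -ab; rewrite /evenz; lia.
Qed.

(** * Losses have positive density *)

Definition nonopt (W : seq pixel) (P : nat) (z : pixel) : bool := ~~ `[< optimal W P z >].

Definition defect (W : seq pixel) (P : nat) (z : pixel) : nat :=
  (bad W z + (z \in W) * nonopt W P z)%N.

Definition disk (r : nat) : seq pixel :=
  [seq (i%:Z - r%:Z, j%:Z - r%:Z) | i <- iota 0 r.*2.+1, j <- iota 0 r.*2.+1].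

Lemma mem_disk r (d : pixel) : (d \in disk r) = (`|d.1| <= r%:Z) && (`|d.2| <= r%:Z).
Proof.
apply/idP/idP => [/allpairsP [[i j] [hi hj ->]]|h].
  by move: hi hj; rewrite !mem_iota /=; clear; lia.
apply/allpairsP; exists (absz (d.1 + r%:Z), absz (d.2 + r%:Z)); rewrite !mem_iota /=.
by case: d h => x y /= h; split; [lia|lia|apply: pixel_eq; lia].
Qed.

Lemma near_shift r z0 z : near r z0 z -> exists2 d, d \in disk r & z = shift d z0.
Proof.
move=> h; exists (z.1 - z0.1, z.2 - z0.2).
  by rewrite mem_disk.
by case: z z0 h => x y [x0 y0] /= _; apply: pixel_eq => /=; lia.
Qed.

Definition spread (r : nat) (G : pixel -> nat) (z : pixel) : nat :=
  (\sum_(d <- disk r) G (shift d z))%N.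

Lemma spread0 r G z y : spread r G z = 0%N -> near r z y -> G y = 0%N.
Proof.
move=> s0 /near_shift [d dr ->]; apply/eqP.
by move/eqP: s0; rewrite /spread sum_nat_seq_eq0 => /allP /(_ d dr).
Qed.

Lemma sum_spread (B W : seq pixel) r G : uniq B -> uniq W ->
  (forall z d, z \in W -> d \in disk r -> shift d z \in B) ->
  (\sum_(z <- W) spread r G z <= size (disk r) * \sum_(b <- B) G b)%N.
Proof.
move=> uB uW WB; rewrite exchange_big /=; set X := (\sum_(b <- B) _)%N.
have -> : (size (disk r) * X = \sum_(d <- disk r) X)%N.
  by rewrite big_const_seq count_predT iter_addn_0 mulnC.
rewrite big_seq [leqRHS]big_seq; apply: leq_sum => d dr.
by apply: sum_shift_le => // z zW; exact: WB.
Qed.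

Lemma not_bad_tight (W : seq pixel) z :
  (forall y, near 1 z y -> ~~ bad W y) -> tight_at (mem W) z.
Proof.
move=> nb e f ea fe; pose w (x y : int) : bool := shift (x, y) z \in W.
have S (x y x' y' : int) : shift (x, y) (shift (x', y') z) = shift (x' + x, y' + y) z.
  by rewrite /shift /= !addrA.
have Z : z = shift (0, 0) z by rewrite /shift /= !addr0 -surjective_pairing.
have H (x y : int) : (x, y) \in disk 1 -> (2 <= w (x + 0)%R (y + 0)%R + w (x + 1)%R (y + 0)%R +
    w (x + 0)%R (y + 1)%R + w (x + 1)%R (y + 1)%R)%N.
  move=> dd; have : (2 <= whites W (shift (x, y) z))%N.
    rewrite ltnNge; apply: nb; move: dd; rewrite mem_disk /near /shift /=.
    by clear; lia.
  by rewrite /whites !big_cons big_nil !S addn0 !addnA.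
have m1 : (2 <= w 0%R 0%R + w 1%R 0%R + w 0%R 1%R + w 1%R 1%R)%N by exact: (H (0) (0) isT).
have m2 : (2 <= w (-1)%R 0%R + w 0%R 0%R + w (-1)%R 1%R + w 0%R 1%R)%N by exact: (H (-1) (0) isT).
have m3 : (2 <= w 0%R (-1)%R + w 1%R (-1)%R + w 0%R 0%R + w 1%R 0%R)%N by exact: (H (0) (-1) isT).
have m4 : (2 <= w (-1)%R (-1)%R + w 0%R (-1)%R + w (-1)%R 0%R + w 0%R 0%R)%N by exact: (H (-1) (-1) isT).
move: ea fe; rewrite !inE => /or4P[]/eqP-> /orP[]/eqP->; rewrite /= {1}Z !S.
- by change (2 <= w 0%R 0%R + w 1%R 0%R + w 0%R 1%R + w 1%R 1%R)%N; move: m1; clear; lia.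
- by change (2 <= w 0%R 0%R + w 1%R 0%R + w 0%R (-1)%R + w 1%R (-1)%R)%N; move: m3; clear; lia.
- by change (2 <= w 0%R 0%R + w (-1)%R 0%R + w 0%R (-1)%R + w (-1)%R (-1)%R)%N; move: m4; clear; lia.
- by change (2 <= w 0%R 0%R + w (-1)%R 0%R + w 0%R 1%R + w (-1)%R 1%R)%N; move: m2; clear; lia.
- by change (2 <= w 0%R 0%R + w 0%R 1%R + w (-1)%R 0%R + w (-1)%R 1%R)%N; move: m2; clear; lia.
- by change (2 <= w 0%R 0%R + w 0%R 1%R + w 1%R 0%R + w 1%R 1%R)%N; move: m1; clear; lia.
- by change (2 <= w 0%R 0%R + w 0%R (-1)%R + w 1%R 0%R + w 1%R (-1)%R)%N; move: m3; clear; lia.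
- by change (2 <= w 0%R 0%R + w 0%R (-1)%R + w (-1)%R 0%R + w (-1)%R (-1)%R)%N; move: m4; clear; lia.
Qed.

Lemma defect0_regular (W : seq pixel) P r R z : (R < r)%N ->
  spread r (defect W P) z = 0%N -> regular (mem W) P z R.
Proof.
move=> Rr s0 y yR; have df x : near r z x -> defect W P x = 0%N by exact: spread0.
split.
  apply: not_bad_tight => x xy; have /df : near r z x.
    by move: yR xy; clear -Rr; rewrite /near; lia.
  by rewrite /defect; case: (bad W x).
move=> yW; have yr : near r z y by move: yR; clear -Rr; rewrite /near; lia.
have : nonopt W P y = false.
  by have := df _ yr; rewrite /defect [y \in W]yW; case: (nonopt _ _ _); case: (bad _ _).
by move=> /negbFE /asboolP /optimal_box; apply.
Qed.

Definition used_count (W : seq pixel) (z : pixel) : nat :=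
  (\sum_(d <- axes) (pointed (mem W) z d && (shift d (shift d z) \notin W)))%N.

Definition unused_count (W : seq pixel) (z : pixel) : nat :=
  (\sum_(d <- axes) (pointed (mem W) z d && (shift d (shift d z) \in W)))%N.

Lemma pointed_split (W : seq pixel) z :
  pointed_count W z = (used_count W z + unused_count W z)%N.
Proof.
rewrite /pointed_count /used_count /unused_count -big_split /=; apply: eq_bigr => d _.
by case: (pointed _ _ _); case: (_ \in W).
Qed.

Lemma pointed_flat_sum (W : seq pixel) (P : nat) : (2 <= P)%N -> uniq W ->
  (2 * \sum_(z <- W) pointed_count W z <=
     \sum_(z <- W) flat_count W z + 8 * \sum_(z <- W) nonopt W P z)%N.
Proof.
move=> P2 uW; rewrite !big_distrr -big_split /=; apply: (sum_components_nat d4C) => x xW.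
have [ox|nx] := boolP (nonopt W P x).
  rewrite [leqLHS]big_seq [leqRHS]big_seq; apply: leq_sum => y yx.
  have -> : nonopt W P y.
    apply/asboolP => oy; case/asboolP: ox; apply: optimal_class oy; exact: class_sym.
  apply: leq_trans (leq_addl _ _).
  rewrite /pointed_count !big_cons big_nil.
  by do 4!case: (pointed _ _ _).
move: nx => /negbNE /asboolP ox.
rewrite -big_distrr /= big_split /=.
have := optimal_pointed P2 uW ox; have := optimal_flat P2 ox; clear; lia.
Qed.

Lemma sum_shift_self (W : seq pixel) (d : pixel) (G : pixel -> nat) : uniq W ->
  (\sum_(z <- W) (shift d z \in W) * G (shift d z) <= \sum_(z <- W) G z)%N.
Proof.
move=> uW; pose B := undup (W ++ map (shift (antipode d)) W).
have uB : uniq B by exact: undup_uniq.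
rewrite -[leqRHS](@sum_shift_mem B W d) //; last first.
  by move=> z zW; rewrite mem_undup mem_cat map_f ?orbT.
rewrite [leqLHS](_ : _ = \sum_(z <- W | z \in B) (shift d z \in W) * G (shift d z))%N; last first.
  rewrite [LHS]big_seq [RHS]big_seq_cond; apply: eq_bigl => z.
  by rewrite mem_undup mem_cat; case: (z \in W).
rewrite -big_filter [leqRHS](bigID (mem W)) /=.
have E : perm_eq [seq z <- W | z \in B] [seq z <- B | z \in W].
  by apply: uniq_perm; rewrite ?filter_uniq // => z; rewrite !mem_filter andbC.
by rewrite (perm_big _ E) big_filter leq_addr.
Qed.

Lemma flat_sum (W : seq pixel) P r : uniq W -> (3 < r)%N ->
  (\sum_(z <- W) flat_count W z <=
    2 * \sum_(z <- W) used_count W z + 8 * \sum_(z <- W) spread r (defect W P) z)%N.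
Proof.
move=> uW r3; set D := (\sum_(z <- W) spread _ _ _)%N.
have one e f : e \in axes -> f \in normals e ->
    (\sum_(z <- W) flat (mem W) z e f <=
     \sum_(z <- W) (pointed (mem W) z e && (shift e (shift e z) \notin W)) + D)%N.
  move=> ea fe; pose G z : nat := (pointed (mem W) z e && (shift e (shift e z) \notin W)).
  pose c := shift f (antipode e).
  have cE z : shift c z = beside z e f.
    by rewrite /beside /c /shift /= !addrA addrAC [z.2 + _ + _]addrAC.
  apply: leq_trans (leq_add (sum_shift_self c G uW) (leqnn D)).
  rewrite /D -big_split /= big_seq [leqRHS]big_seq; apply: leq_sum => z zW.
  have [s0|s0] := posnP (spread r (defect W P) z); last first.
    by apply: (leq_trans _ (leq_trans s0 (leq_addl _ _))); case: (flat _ _ _ _).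
  have reg := defect0_regular r3 s0; have h := flat_used ea fe reg.
  rewrite cE /G s0 addn0.
  case fz : (flat _ _ _ _) => //.
  by have [h1 h2 h3] := h zW fz; rewrite h2 [beside z e f \in W]h1 /= h3.
rewrite /flat_count exchange_big /=.
have two e : e \in axes -> (\sum_(z <- W) \sum_(f <- normals e) flat (mem W) z e f <=
     2 * \sum_(z <- W) (pointed (mem W) z e && (shift e (shift e z) \notin W)) + 2 * D)%N.
  move=> ea; rewrite exchange_big /= !big_cons big_nil addn0.
  have h2 : antipode (perp e) \in normals e by rewrite !inE eqxx orbT.
  apply: leq_trans (leq_add (one e _ ea (mem_head _ _)) (one e _ ea h2)) _.
  by rewrite addnACA !addnn -!mul2n.
have -> : (8 * D = \sum_(e <- axes) 2 * D)%N by rewrite !big_cons big_nil; clear; lia.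
rewrite /used_count [X in (2 * X + _)%N]exchange_big /= big_distrr -big_split /=.
by rewrite big_seq [leqRHS]big_seq; apply: leq_sum => e /two.
Qed.

Lemma sum_mem_restrict (B W : seq pixel) (G : pixel -> nat) : uniq B -> uniq W ->
  {subset W <= B} -> (\sum_(b <- B) (b \in W) * G b = \sum_(z <- W) G z)%N.
Proof.
move=> uB uW W_B; have := @sum_shift_mem B W (0, 0) G uB uW.
have S0 (z : pixel) : shift (0, 0) z = z by rewrite /shift /= !addr0 -surjective_pairing.
move=> <-; first by apply: eq_bigr => b _; rewrite S0.
by move=> z zW; rewrite (_ : antipode _ = (0, 0)) // S0; exact: W_B.
Qed.

Lemma size_le_defects (B W : seq pixel) P r : (2 <= P)%N -> uniq B -> uniq W ->
  (3 * P + 10 < r)%N ->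
  (forall z d, z \in W -> d \in disk r -> shift d z \in B) ->
  (size W <= size (disk r) * (4 * size (disk r) + 5) * \sum_(b <- B) defect W P b)%N.
Proof.
move=> P2 uB uW rP WB.
have W_B z : z \in W -> z \in B.
  move=> zW; have := WB z (0, 0) zW.
  by rewrite mem_disk /= /shift /= !addr0 -surjective_pairing; apply.
set M := size (disk r); set DB := (\sum_(b <- B) _)%N; set DW := (\sum_(z <- W) spread r (defect W P) z)%N.
have hDW : (DW <= M * DB)%N by exact: sum_spread.
have restrict G := sum_mem_restrict G uB uW W_B.
have hN : (\sum_(z <- W) nonopt W P z <= DB)%N.
  by rewrite -restrict; apply: leq_sum => b _; exact: leq_addl.
have hU : (\sum_(z <- W) unused_count W z <= 4 * DW + 4 * DB)%N.
  have r3 : (3 < r)%N by clear -rP P2; lia.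
  have := flat_sum P uW r3; have := pointed_flat_sum P2 uW.
  rewrite (eq_bigr (fun z => (used_count W z + unused_count W z)%N)); last first.
    by move=> z _; exact: pointed_split.
  by rewrite big_split /= -/DW; clear -hN; lia.
have h1 : (size W <= \sum_(z <- W) spread r (fun b => defect W P b + (b \in W) * unused_count W b) z)%N.
  rewrite -sum1_size big_seq [leqRHS]big_seq; apply: leq_sum => z zW.
  rewrite lt0n; apply/eqP => s0.
  have s1 : spread r (defect W P) z = 0%N.
    apply/eqP; move/eqP: s0; rewrite /spread !sum_nat_seq_eq0; apply: sub_all => b /=.
    by rewrite addn_eq0 => /andP[].
  have reg := defect0_regular rP s1.
  apply: (@not_perfect (mem W) P z P2 zW) => y yn; have [ty by_] := reg y yn; split=> //.
  move=> d da yW py; apply/negP => dW.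
  have : near r z y by move: yn; clear -rP; rewrite /near; lia.
  move=> /(spread0 s0); rewrite [y \in W]yW mul1n => /eqP; rewrite addn_eq0 => /andP[_].
  rewrite /unused_count sum_nat_seq_eq0 => /allP /(_ d da).
  by rewrite /= py (dW : _ \in W).
apply: leq_trans h1 _; apply: leq_trans (sum_spread _ uB uW WB) _.
rewrite -mulnA leq_mul // big_split /= restrict -/DB.
have : (4 * (M * DB) + 5 * DB = (4 * M + 5) * DB)%N by clear; nia.
by clear -hDW hU; lia.
Qed.

Lemma disk_uniq r : uniq (disk r).
Proof.
apply: allpairs_uniq; rewrite ?iota_uniq // => -[i j] [i' j'] _ _ [] /= h1 h2.
by congr (_, _); [move: h1 | move: h2]; clear; lia.
Qed.

Lemma size_disk r : size (disk r) = (r.*2.+1 ^ 2)%N.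
Proof. by rewrite size_allpairs !size_iota. Qed.

Lemma disk_shift n r z d : z \in disk n -> d \in disk r -> shift d z \in disk (n + r).
Proof. by rewrite !mem_disk /shift /=; lia. Qed.

Definition whites_in (I : binary_image) (n : nat) : seq pixel := [seq z <- disk n | I z].

Lemma whites_in_uniq I n : uniq (whites_in I n).
Proof. by rewrite filter_uniq // disk_uniq. Qed.

Lemma whites_in_sub I n : {subset whites_in I n <= I}.
Proof. by move=> z; rewrite mem_filter => /andP[]. Qed.

Lemma white_countE I n : white_count I n.*2.+1 = size (whites_in I n).
Proof.
pose pos (p : 'I_n.*2.+1 * 'I_n.*2.+1) : pixel := (p.1%:Z - n%:Z, p.2%:Z - n%:Z).
have -> : white_count I n.*2.+1 = #|[set p | I (pos p)]%SET|.
  by apply: eq_card => p; rewrite !inE /pos (_ : (n.*2.+1)./2 = n) //; clear; lia.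
rewrite cardE -(size_map pos); apply: perm_size; apply: uniq_perm.
- rewrite map_inj_uniq ?enum_uniq // => -[i j] [i' j'] [] h1 h2.
  by congr (_, _); apply: val_inj; [move: h1 | move: h2]; clear; rewrite /=; lia.
- exact: whites_in_uniq.
move=> z; rewrite mem_filter mem_disk; apply/mapP/andP.
  move=> [[i j]]; rewrite mem_enum inE => Iz ->; split=> //.
  by have := ltn_ord i; have := ltn_ord j; rewrite /pos /=; clear; lia.
move=> [Iz zn].
have lt (x : int) : `|x| <= n%:Z -> (absz (x + n%:Z)%R < n.*2.+1)%N by clear; lia.
have eqx (x : int) : `|x| <= n%:Z -> x = (absz (x + n%:Z)%R)%:Z - n%:Z by clear; lia.
case/andP: zn => z1 z2; have i1 := lt _ z1; have i2 := lt _ z2.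
have zE : z = pos (Ordinal i1, Ordinal i2).
  by rewrite [LHS]surjective_pairing /pos /= -!eqx.
by exists (Ordinal i1, Ordinal i2) => //; rewrite mem_enum inE -zE.
Qed.

Lemma corner_disk c : c \in corners -> antipode c \in disk 1.
Proof. by rewrite mem_disk !inE => /or4P[]/eqP->. Qed.

Lemma disk_mono r r' d : (r <= r')%N -> d \in disk r -> d \in disk r'.
Proof. by rewrite !mem_disk; lia. Qed.

Lemma sum1_seqr (R : numDomainType) (T : Type) (s : seq T) :
  \sum_(z <- s) (1 : R) = (size s)%:R.
Proof. by rewrite -sum1_size natr_sum. Qed.

Lemma bound8 (R : realType) (I : binary_image) (k n : nat) (l : R) :
  components_le d8 k I -> 0 <= l ->
  (forall j w h : nat, (1 <= j <= k)%N -> (j <= w * h)%N -> j%:R <= l * (j + w + h + 1)%:R) ->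
  (size (whites_in I n))%:R <= l * (size (disk (n + 1)))%:R.
Proof.
move=> Ik l0 hl; set W := whites_in I n; set B := disk (n + 1).
have uW : uniq W := whites_in_uniq I n; have uB : uniq B := disk_uniq _.
have WB c z : c \in corners -> z \in W -> shift (antipode c) z \in B.
  by move=> /corner_disk cc; rewrite mem_filter => /andP[_ zn]; exact: disk_shift.
apply: (@le_trans _ _ (\sum_(z <- W) l * (rep_count B W z)%:R)); last first.
  rewrite -mulr_sumr ler_wpM2l // -natr_sum ler_nat rep_count_sum // -sum1_size.
  by apply: leq_sum => b _; case: (_ \in _).
rewrite -sum1_size natr_sum; apply: (sum_components d8C) => x xW.
have [w [h [jwh le]]] := component8_blocks uW xW WB.
rewrite -mulr_sumr -natr_sum -natr_sum sum1_size.
apply: (le_trans (hl _ w h _ jwh)).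
  rewrite (component_size d8C uW _ Ik xW); last exact: whites_in_sub.
  by rewrite andbT; have := component_self d8C xW; case: (component _ _ _).
by rewrite ler_wpM2l // ler_nat.
Qed.

Lemma component4_exits (W : seq pixel) x : uniq W -> x \in W ->
  exists (u0 v0 : int) (a b : nat),
   [/\ {subset component d4 W x <= inbox u0 v0 a b},
       (2 * size (component d4 W x) <= a * b + 1)%N
     & (2 * (a + b) <= \sum_(z <- component d4 W x) exits W z)%N].
Proof.
move=> uW xW; have [u0 [v0 [a [b [sub le]]]]] := component_exits uW xW.
exists u0, v0, a, b; split=> //; apply: inbox_card sub.
exact: filter_uniq.
Qed.

Lemma bound4 (R : realType) (I : binary_image) (k n : nat) (l : R) :
  components_le d4 k I -> 0 <= l ->
  (forall j a b : nat, (1 <= j <= k)%N -> (2 * j <= a * b + 1)%N ->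
     j%:R <= l * (j%:R + (a + b)%:R / 2)) ->
  (size (whites_in I n))%:R <= l * (size (disk (n + 1)))%:R.
Proof.
move=> Ik l0 hl; set W := whites_in I n; set B := disk (n + 1).
have uW : uniq W := whites_in_uniq I n; have uB : uniq B := disk_uniq _.
have WB c z : c \in corners -> z \in W -> shift (antipode c) z \in B.
  by move=> /corner_disk cc; rewrite mem_filter => /andP[_ zn]; exact: disk_shift.
apply: (@le_trans _ _ (\sum_(z <- W) l * (1 + (exits W z)%:R / 4))); last first.
  rewrite -mulr_sumr ler_wpM2l // big_split /= sum1_seqr -mulr_suml -natr_sum.
  have := exits_sum uB uW WB.
  rewrite -(ler_nat R) !natrD !natrM => h.
  have : 0 <= (\sum_(b <- B) bad W b)%:R :> R by [].
  by clear -h; move: h; set x := (\sum_(z <- W) _)%:R; set y := (size W)%:R; set t := (size B)%:R; set s := (\sum_(b <- B) _)%:R; lra.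
rewrite -sum1_seqr; apply: (sum_components d4C) => x xW.
have [u0 [v0 [a [b [_ jab le]]]]] := component4_exits uW xW.
rewrite -mulr_sumr big_split /= !sum1_seqr -mulr_suml -natr_sum.
apply: (le_trans (hl _ a b _ jab)).
  rewrite (component_size d4C uW _ Ik xW); last exact: whites_in_sub.
  by rewrite andbT; have := component_self d4C xW; case: (component _ _ _).
rewrite ler_wpM2l // lerD2l; move: le; rewrite -(ler_nat R) natrM => le.
by clear -le; move: le; set X := (\sum_(z <- _) _)%:R; set Y := (a + b)%:R; lra.
Qed.

Lemma triangular_gap (P T j a b : nat) : (2 <= P)%N -> (2 * T = P * P.+1)%N -> (1 <= j)%N ->
  (4 * j <= 4 * T + P)%N -> (2 * j <= a * b + 1)%N ->
  ((2 * P + 1) * j < T * (a + b))%N \/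
  [/\ (2 * P + 1) * j = T * (a + b), j = T & (a = P /\ b = P.+1) \/ (a = P.+1 /\ b = P)]%N.
Proof.
move=> P2 TE j1 jT jab.
have am : (4 * (a * b) <= (a + b) ^ 2)%N by case: (nat_AGM2 a b).
set s := (a + b)%N in am *.
have [big|] := leqP (2 * P + 2) s.
  by left; have := leq_mul (leqnn T) big; nia.
rewrite leq_eqVlt => /orP[/eqP sE|small].
  have s2 : s = (2 * P + 1)%N by lia.
  have ab2 : (a * b <= 2 * T)%N by rewrite s2 in am; nia.
  have jle : (j <= T)%N by lia.
  have [jlt|jge] := ltnP j T; first by left; rewrite s2; nia.
  right; have jT' : j = T by lia.
  split=> //; first by rewrite jT' s2 mulnC.
  have bE : b = (2 * P + 1 - a)%N by rewrite /s in s2; lia.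
  have aP : (a <= 2 * P + 1)%N by rewrite /s in s2; lia.
  have : (a = P \/ a = P.+1)%N.
    have [a1|a1] := leqP a P.
      have [//|a2] := eqVneq a P; first by left.
      exfalso; have a3 : (a.+1 <= P)%N by lia.
      have [c cE] : exists c, P = (a + 1 + c)%N by exists (P - a - 1)%N; lia.
      subst P; have bE' : b = (a + 3 + c + c)%N by lia.
      subst b; nia.
    have [//|a2] := eqVneq a P.+1; first by right.
    exfalso; have [c cE] : exists c, a = (P + 2 + c)%N by exists (a - P - 2)%N; lia.
    subst a; have bc : (b + c + 1 = P)%N by lia.
    subst P; nia.
  by case=> aE; [left | right]; split => //; lia.
left; have sP : (s <= 2 * P)%N by lia.
have [P3|P3] := leqP 3 P; last first.
  have PE : P = 2%N by lia.
  subst P; have TE' : T = 3%N by lia.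
  subst T; have : (a <= 4)%N by lia.
  have : (b <= 4)%N by lia.
  rewrite /s in sP *; move: jab sP j1; clear.
  case: a => [|[|[|[|[|//]]]]]; case: b => [|[|[|[|[|//]]]]]; lia.
have j8 : (8 * j <= s ^ 2 + 4)%N by lia.
have s1 : (2 <= s)%N by clear - am jab j1; case: s am => [|[|//]]; lia.
have : ((2 * P + 1) * (s ^ 2 + 4) < 8 * (T * s))%N.
  have -> : (8 * (T * s) = 4 * (P * P.+1) * s)%N by rewrite -TE; lia.
  have [c cE] : exists c, (2 * P = s + c)%N by exists (2 * P - s)%N; lia.
  have [e eE] : exists e, (s = 2 + e)%N by exists (s - 2)%N; lia.
  clear -P3 cE eE; nia.
by have := leq_mul (leqnn (2 * P + 1)) j8; rewrite mulnCA; clear; lia.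
Qed.

Lemma defect_arithmetic (t q C w E b N S : nat) : (1 <= t)%N -> (w <= C * (b + N))%N ->
  (E + b + 4 * w <= 4 * S)%N -> (q * w + N <= t * E)%N ->
  (((4 * t + q) * C + 1) * w <= C * (4 * t) * S)%N.
Proof.
move=> t1 hW hE hK.
have h : (4 * t * w + q * w + (b + N) <= 4 * t * S)%N.
  by have := leq_mul (leqnn t) hE; have := leq_pmull b t1; lia.
by have := leq_mul (leqnn C) h; lia.
Qed.

Lemma bound4_strict (k P T : nat) : (2 <= P)%N -> (2 * T = P * P.+1)%N ->
  (1 <= k)%N -> (4 * k <= 4 * T + P)%N ->
  exists C r : nat, (0 < C)%N /\ forall (I : binary_image) (n : nat), components_le d4 k I ->
    (((4 * (k * T) + k * (2 * (2 * P + 1))) * C + 1) * size (whites_in I n) <=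
      C * (4 * (k * T)) * size (disk (n + r)))%N.
Proof.
move=> P2 TE k1 kT; pose r := (3 * P + 11)%N; pose M := size (disk r).
exists (M * (4 * M + 5))%N, r; split.
  by rewrite /M size_disk muln_gt0 expn_gt0 /= addn_gt0 orbT.
move=> I n Ik; set W := whites_in I n; set B := disk (n + r).
have uW : uniq W := whites_in_uniq I n; have uB : uniq B := disk_uniq _.
have WBr z d : z \in W -> d \in disk r -> shift d z \in B.
  by rewrite mem_filter => /andP[_ zn]; exact: disk_shift.
have WB c z : c \in corners -> z \in W -> shift (antipode c) z \in B.
  by move=> /corner_disk cc zW; apply: WBr => //; apply: disk_mono cc; rewrite /r addnC.
have W_B : {subset W <= B}.
  by move=> z; rewrite mem_filter => /andP[_]; apply: disk_mono; exact: leq_addr.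
have rP : (3 * P + 10 < r)%N by rewrite /r; clear; lia.
have := size_le_defects P2 uB uW rP WBr; rewrite -/M.
set C := (M * _)%N; rewrite /defect big_split /= sum_mem_restrict // => hW.
have hE := exits_sum uB uW WB.
set D := (2 * (2 * P + 1))%N.
have hK : (\sum_(z <- W) (k * D + nonopt W P z) <= \sum_(z <- W) k * T * exits W z)%N.
  apply: (sum_components_nat d4C) => x xW.
  have [u0 [v0 [a [b [sub jab le]]]]] := component4_exits uW xW.
  set K := component d4 W x in sub jab le *.
  have uK : uniq K by exact: filter_uniq.
  have jk : (size K <= k)%N by apply: (component_size d4C uW _ Ik xW); exact: whites_in_sub.
  have j1 : (1 <= size K)%N by have := component_self d4C xW; rewrite /K; case: (component _ _ _).
  have jT : (4 * size K <= 4 * T + P)%N by clear -jk kT; lia.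
  rewrite big_split /=.
  have -> : (\sum_(i <- K) k * D = k * D * size K)%N.
    by rewrite big_const_seq count_predT iter_addn_0.
  rewrite -big_distrr /=.
  apply: leq_trans (leq_mul (leqnn (k * T)) le).
  have [lt|[eq jE ab]] := triangular_gap P2 TE j1 jT jab.
    have nK : (\sum_(z <- K) nonopt W P z <= k)%N.
      apply: leq_trans jk; rewrite -sum1_size; apply: leq_sum => z _.
      by case: (nonopt _ _ _).
    have : (k * ((2 * P + 1) * size K).+1 <= k * (T * (a + b)))%N by rewrite leq_mul2l lt orbT.
    by clear -nK; rewrite /D; nia.
  have opt z : z \in K -> nonopt W P z = false.
    move=> zK; apply/negbF/asboolP; apply: (optimal_class zK).
    exists u0, v0, a, b; split=> // y; apply/idP/idP; first exact: sub.
    apply: (inbox_full uK sub) => //; first by clear -jE ab TE; nia.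
    have : (a * b = P * P.+1)%N by case: ab => -[-> ->] //; rewrite mulnC.
    by move=> ->; rewrite oddM /=; case: (odd P).
  rewrite (eq_big_seq (fun=> 0%N)); last by move=> z /opt ->.
  rewrite big1_eq addn0 /D; clear -eq; nia.
have {}hK : (k * D * size W + \sum_(z <- W) nonopt W P z <= k * T * \sum_(z <- W) exits W z)%N.
  have cst : (\sum_(z <- W) k * D = k * D * size W)%N.
    by rewrite big_const_seq count_predT iter_addn_0.
  by move: hK; rewrite big_split cst -big_distrr.
have kT1 : (1 <= k * T)%N by rewrite muln_gt0 k1; clear -TE P2; nia.
exact: defect_arithmetic kT1 hW hE hK.
Qed.

(** * Densities *)

Section LiminfBounds.
Variables (R : realType) (u : nat -> R) (l K : R) (N0 : nat).
Hypothesis u01 : forall n, 0 <= u n <= 1.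

Lemma unit_bounded : bounded_fun (u : nat -> R^o).
Proof.
exists 1; split; first exact: num_real.
by move=> x x1 n _ /=; have /andP[u0 u1] := u01 n; rewrite ger0_norm // (le_trans u1) // ltW.
Qed.

Lemma inv_eventually_le (e : R) : 0 < e -> exists N, forall n, (N <= n)%N -> K / n.+1%:R <= e.
Proof.
move=> e0; exists (Num.bound (`|K| / e)) => n nN.
have : `|K| / e < n.+1%:R.
  apply: lt_le_trans (archi_boundP _) _; first by rewrite divr_ge0 // ltW.
  by rewrite ler_nat leqW.
rewrite ltr_pdivrMr // => h; rewrite ler_pdivrMr // (le_trans (ler_norm _)) //.
by rewrite mulrC ltW.
Qed.

Lemma limn_inf_le : (forall n, (N0 <= n)%N -> u n <= l + K / n.+1%:R) ->
  limn_inf (u : nat -> R^o) <= l.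
Proof.
move=> ul; rewrite (limn_infE unit_bounded); apply: ge_sup.
  by exists (infs (u : nat -> R^o) 0%N); exists 0%N.
move=> _ [n _ <-]; apply/ler_addgt0Pr => e e0.
have [N hN] := inv_eventually_le e0; pose m := maxn n (maxn N0 N).
apply: (@le_trans _ _ (u m)).
  apply: ge_inf; last by exists m => //=; exact: leq_maxl.
  by exists 0 => _ [k _ <-]; have /andP[] := u01 k.
apply: (le_trans (ul m _)); first by rewrite !leq_max leqnn orbT.
by rewrite lerD2l hN // !leq_max leqnn !orbT.
Qed.

Lemma limn_inf_ge : (forall n, (N0 <= n)%N -> l - K / n.+1%:R <= u n) ->
  l <= limn_inf (u : nat -> R^o).
Proof.
move=> ul; rewrite (limn_infE unit_bounded); apply/ler_addgt0Pr => e e0.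
have [N hN] := inv_eventually_le e0; pose m := maxn N0 N.
rewrite -lerBlDr; apply: (@le_trans _ _ (infs (u : nat -> R^o) m)); last first.
  apply: ub_le_sup; last by exists m.
  exact: bounded_fun_has_ubound_infs unit_bounded.
apply: lb_le_inf; first by exists (u m); exists m => /=.
move=> _ [k /= mk <-]; apply: le_trans (ul k _).
  by rewrite lerD2l lerN2 hN // (leq_trans _ mk) // leq_maxr.
by rewrite (leq_trans _ mk) // leq_maxl.
Qed.

End LiminfBounds.

Lemma whites_ratio01 (R : realType) (I : binary_image) (n : nat) :
  0 <= ((white_count I n.*2.+1)%:R / n.*2.+1%:R ^+ 2 : R) <= 1.
Proof.
rewrite divr_ge0 ?exprn_ge0 //= ler_pdivrMr ?exprn_gt0 // mul1r -natrX ler_nat.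
by rewrite white_countE size_filter -size_disk count_size.
Qed.

Lemma square_growth (R : realFieldType) (t x y q : R) : 0 <= y -> q * x = y -> 0 <= q ->
  x <= t -> y <= t -> (t + 2 * y) ^+ 2 <= (1 + 8 * q) * t ^+ 2.
Proof.
move=> y0 qx q0 xt yt; have yq : y <= q * t by rewrite -qx ler_wpM2l.
have -> : (t + 2 * y) ^+ 2 = t ^+ 2 + 4 * (y * t) + 4 * (y * y) by ring.
have -> : (1 + 8 * q) * t ^+ 2 = t ^+ 2 + 8 * ((q * t) * t) by ring.
have : y * y <= y * t by rewrite ler_wpM2l.
have : y * t <= q * t * t by rewrite ler_wpM2r // (le_trans y0).
by lra.
Qed.

Lemma density_le (R : realType) (I : binary_image) (l : R) (r : nat) : 0 <= l ->
  (forall n, (size (whites_in I n))%:R <= l * (size (disk (n + r)))%:R) ->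
  white_density R I <= l.
Proof.
move=> l0 h; apply: (@limn_inf_le R _ l (l * (8 * r)%:R) r) => n.
  exact: whites_ratio01.
move=> rn; rewrite white_countE.
have m0 : 0 < n.*2.+1%:R :> R by [].
rewrite ler_pdivrMr ?exprn_gt0 //; apply: le_trans (h n) _.
rewrite (_ : l + _ = l * (1 + (8 * r)%:R / n.+1%:R)); last by rewrite mulrDr mulr1 mulrA.
rewrite -mulrA ler_wpM2l // size_disk natrX.
have n0 : 0 < n.+1%:R :> R by [].
have eM : n.*2.+1%:R = 2 * n.+1%:R - 1 :> R by rewrite -muln2 -natr1 natrM -[n.+1%:R]natr1; lra.
have eA : (n + r).*2.+1%:R = n.*2.+1%:R + 2 * r%:R :> R.
  by rewrite -!muln2 -!natr1 !natrM natrD; lra.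
have rn' : r%:R <= n%:R :> R by rewrite ler_nat.
have nn : n.+1%:R = n%:R + 1 :> R by rewrite natr1.
rewrite eA natrM -mulrA; set x := n.+1%:R in n0 eM nn *; set y := r%:R in rn' *.
have y0 : 0 <= y by [].
set t := n.*2.+1%:R in eM m0 *.
have : y / x * x = y by rewrite divfK // gt_eqF.
have : 0 <= y / x by rewrite divr_ge0 // ltW.
set q := y / x => q0 qx.
have x1 : 1 <= x by rewrite nn lerDr.
have tx : x <= t by rewrite eM; lra.
have yt' : y <= t by rewrite eM; lra.
exact: (square_growth y0 qx q0 tx yt').
Qed.

Lemma sum_blocks (f : nat -> nat) q N :
  (\sum_(0 <= i < q * N) f i = \sum_(0 <= a < q) \sum_(0 <= i < N) f (a * N + i))%N.
Proof.
elim: q => [|q IH]; first by rewrite mul0n !big_geq.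
rewrite [RHS]big_nat_recr //= -IH mulSn (@big_cat_nat _ _ _ (q * N)) ?leq_addl //=.
congr (_ + _)%N; rewrite -{1}[(q * N)%N]add0n big_addn addnK.
by apply: eq_bigr => i _; rewrite addnC.
Qed.

Lemma leq_sum_nat_widen (f : nat -> nat) m n : (m <= n)%N ->
  (\sum_(0 <= i < m) f i <= \sum_(0 <= i < n) f i)%N.
Proof. by move=> mn; rewrite [leqRHS](big_cat_nat (leq0n m) mn) //= leq_addr. Qed.

Lemma sum_nat_geq (f : nat -> nat) c n : (forall i, c <= f i)%N ->
  (n * c <= \sum_(0 <= i < n) f i)%N.
Proof.
move=> h; rewrite -[n in (n * c)%N]subn0 -sum_nat_const_nat.
by apply: leq_sum => i _; exact: h.
Qed.

Lemma sum_windows (f : nat -> nat -> nat) m N c q : (q * N <= m)%N ->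
  (forall a b, c <= \sum_(0 <= i < N) \sum_(0 <= j < N) f (a * N + i) (b * N + j))%N ->
  (q * (q * c) <= \sum_(0 <= i < m) \sum_(0 <= j < m) f i j)%N.
Proof.
move=> qm h; apply: leq_trans (leq_sum_nat_widen _ qm); rewrite sum_blocks.
apply: sum_nat_geq => a; apply: leq_trans (_ : \sum_(0 <= i < N)
  \sum_(0 <= j < q * N) f (a * N + i) j <= _)%N; last first.
  by apply: leq_sum => i _; exact: leq_sum_nat_widen.
rewrite (eq_bigr (fun i => \sum_(0 <= b < q) \sum_(0 <= j < N) f (a * N + i) (b * N + j)))%N.
  by rewrite exchange_big_nat; apply: sum_nat_geq => b; exact: h.
by move=> i _; rewrite sum_blocks.
Qed.

Definition window_count (I : binary_image) (N : nat) (x y : int) : nat :=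
  (\sum_(0 <= i < N) \sum_(0 <= j < N) I (x + i%:Z, y + j%:Z)%R)%N.

Lemma size_whites_in (I : binary_image) n : size (whites_in I n) =
  (\sum_(0 <= i < n.*2.+1) \sum_(0 <= j < n.*2.+1) I (- n%:Z + i%:Z, - n%:Z + j%:Z)%R)%N.
Proof.
rewrite size_filter -sum_count /disk big_allpairs_dep /index_iota subn0.
by apply: eq_bigr => i _; apply: eq_bigr => j _; rewrite ![- _ + _]addrC.
Qed.

Lemma whites_in_windows (I : binary_image) N c n : (forall x y, c <= window_count I N x y)%N ->
  ((n.*2.+1 %/ N) * ((n.*2.+1 %/ N) * c) <= size (whites_in I n))%N.
Proof.
move=> h; rewrite size_whites_in; apply: (@sum_windows _ _ N); first exact: leq_trunc_div.
move=> a b; apply: leq_trans (h (- n%:Z + (a * N)%N%:Z) (- n%:Z + (b * N)%N%:Z)) _.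
rewrite /window_count; apply: leq_sum => i _; apply: leq_sum => j _.
by rewrite !PoszD !addrA.
Qed.

Lemma density_ge (R : realType) (I : binary_image) (N c : nat) : (0 < N)%N ->
  (forall x y, c <= window_count I N x y)%N ->
  c%:R / (N%:R ^+ 2) <= white_density R I.
Proof.
move=> N0 h; apply: (@limn_inf_ge R _ _ (2 * c%:R) 0) => n; first exact: whites_ratio01.
move=> _; rewrite white_countE.
have := whites_in_windows n h; set q := (_ %/ N)%N => hq.
have qN : (n.*2.+1 <= q * N + N)%N by have := divn_eq n.*2.+1 N; rewrite -/q; have := ltn_pmod n.*2.+1 N0; lia.
set t := n.*2.+1 in hq qN *.
have t0 : 0 < t%:R :> R by [].
have NR : 1 <= N%:R :> R by rewrite ler1n.
rewrite ler_pdivlMr ?exprn_gt0 //.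
apply: (@le_trans _ _ (q * (q * c))%N%:R); last by rewrite ler_nat.
have qR : t%:R - N%:R <= q%:R * N%:R :> R.
  by rewrite lerBlDr -natrM -natrD ler_nat.
have nt : n.+1%:R <= t%:R :> R by rewrite ler_nat /t; lia.
have n0 : 0 < n.+1%:R :> R by [].
rewrite !natrM; set x := n.+1%:R in nt n0 *; set T := t%:R in t0 qR nt *.
set Q := q%:R in qR *; set M := N%:R in NR qR *; set C := c%:R.
have C0 : 0 <= C by rewrite /C.
have Q0 : 0 <= Q by rewrite /Q.
have M0 : 0 < M by lra.
have key : T ^+ 2 - 2 * M * T <= (Q * M) ^+ 2.
  have [TM|TM] := leP T M; first by have := sqr_ge0 (Q * M); nra.
  have : (T - M) ^+ 2 <= (Q * M) ^+ 2 by rewrite lerXn2r ?nnegrE //; lra.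
  by have := sqr_ge0 M; nra.
have e1 : (C / M ^+ 2 - 2 * C / x) * T ^+ 2 = C / M ^+ 2 * (T ^+ 2 - 2 * M ^+ 2 * (T ^+ 2 / x)).
  by field; rewrite !gt_eqF.
have e2 : Q * (Q * C) = C / M ^+ 2 * (Q * M) ^+ 2 by field; rewrite gt_eqF.
rewrite e1 e2 ler_wpM2l ?divr_ge0 ?exprn_ge0 ?(ltW M0) //.
apply: le_trans _ key; rewrite lerD2l lerN2.
have Ty : T <= T ^+ 2 / x by rewrite ler_pdivlMr // expr2 ler_wpM2l // ltW.
have MM : M <= M ^+ 2 by rewrite expr2 ler_peMl // ltW.
have -> : 2 * M * T = 2 * (M * T) by rewrite mulrA.
by rewrite -mulrA ler_wpM2l // ler_pM // ltW.
Qed.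

(** * Extremal images *)

Lemma int_shift_const (T : Type) (h : int -> T) : (forall x, h (x + 1) = h x) ->
  forall x y, h x = h y.
Proof.
move=> hS; suff H x : h x = h 0 by move=> x y; rewrite !H.
elim/int_rect: x => [//|n IH|n IH]; rewrite -IH.
  by rewrite -[RHS]hS; congr h; lia.
by rewrite -[LHS]hS; congr h; lia.
Qed.

Lemma periodic_sum (g : int -> nat) (N : nat) : (forall x, g (x + N%:Z) = g x) ->
  forall x y, (\sum_(0 <= i < N) g (x + i%:Z)%R = \sum_(0 <= i < N) g (y + i%:Z)%R)%N.
Proof.
move=> gN; apply: (int_shift_const (h := fun x => \sum_(0 <= i < N) g (x + i%:Z)%R)%N) => x.
case: N gN => [|N] gN; first by rewrite !big_geq.
rewrite big_nat_recr //= [RHS]big_nat_recl //= addnC; congr (_ + _)%N.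
  by rewrite -[in RHS](gN (x + 0)); congr g; lia.
by apply: eq_bigr => i _; congr g; lia.
Qed.

Definition periodic (I : binary_image) (N : nat) : Prop :=
  (forall x y, I (x + N%:Z, y) = I (x, y)) /\ (forall x y, I (x, y + N%:Z) = I (x, y)).

Lemma window_count_const (I : binary_image) N : periodic I N ->
  forall x y x' y', window_count I N x y = window_count I N x' y'.
Proof.
move=> [P1 P2] x y x' y'; rewrite /window_count.
transitivity (\sum_(0 <= i < N) \sum_(0 <= j < N) I (x + i%:Z, y' + j%:Z)%R)%N.
  apply: eq_bigr => i _; apply: (periodic_sum (g := fun t => I (x + i%:Z, t) : nat)) => t.
  by rewrite P2.
apply: (periodic_sum (g := fun t => \sum_(0 <= j < N) I (t, y' + j%:Z)%R)%N) => t.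
by apply: eq_bigr => j _; rewrite P1.
Qed.

Definition residue (al be N : nat) (z : pixel) : nat :=
  absz ((al%:Z * z.1 + be%:Z * z.2) %% N%:Z)%Z.

Definition linear_image (al be N : nat) (white : nat -> bool) : binary_image :=
  fun z => white (residue al be N z).

Lemma residueE al be N z : (0 < N)%N ->
  (residue al be N z)%:Z = ((al%:Z * z.1 + be%:Z * z.2) %% N%:Z)%Z.
Proof. by move=> N0; rewrite /residue gez0_abs // modz_ge0 //; lia. Qed.

Lemma linear_image_periodic al be N white : periodic (linear_image al be N white) N.
Proof.
split=> x y; rewrite /linear_image /residue /=; congr (white (absz _)).
  by rewrite mulrDr addrAC addrC modzMDl.
by rewrite mulrDr addrA addrC modzMDl.
Qed.

(* Translating the window by [(p, q)] adds [1] to every residue, so averaging over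
   [N] such translations makes all the residues equally frequent. *)
Lemma window_count_linear (al be N : nat) (white : nat -> bool) (p q : int) : (0 < N)%N ->
  al%:Z * p + be%:Z * q = 1 ->
  forall x y, window_count (linear_image al be N white) N x y =
    (N * count white (iota 0 N))%N.
Proof.
move=> N0 pq x y; set I := linear_image _ _ _ _.
have cst := window_count_const (linear_image_periodic al be N white) : forall x y x' y',
  window_count I N x y = window_count I N x' y'.
apply/eqP; rewrite -(eqn_pmul2l N0); apply/eqP.
transitivity (\sum_(0 <= k < N) window_count I N (k%:Z * p)%R (k%:Z * q)%R)%N.
  rewrite (eq_bigr (fun=> window_count I N x y)) => [|k _]; last exact: cst.
  by rewrite sum_nat_const_nat subn0.
pose w (t : int) : nat := white (absz (t %% N%:Z)%Z).
have wN t : w (t + N%:Z) = w t by rewrite /w modzDr.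
have w0 : (\sum_(0 <= k < N) w (0 + k%:Z)%R = count white (iota 0 N))%N.
  rewrite -sum1_count [RHS]big_mkcond /index_iota subn0; apply: eq_big_seq => k.
  rewrite mem_iota add0n /= => kN; rewrite /w add0r modz_small; last by lia.
  by rewrite absz_nat; case: (white k).
rewrite /window_count exchange_big_nat /= mulnA.
rewrite (eq_bigr (fun=> N * count white (iota 0 N))%N); last first.
  move=> i _; rewrite exchange_big_nat /=.
  rewrite (eq_bigr (fun=> count white (iota 0 N))) ?sum_nat_const_nat ?subn0 // => j _.
  rewrite -w0 -(periodic_sum wN (al%:Z * i%:Z + be%:Z * j%:Z)); apply: eq_bigr => k _.
  rewrite /w /I /linear_image /residue /=; congr (nat_of_bool (white (absz (_ %% _)%Z))).
  have -> : al%:Z * (k%:Z * p + i%:Z) + be%:Z * (k%:Z * q + j%:Z) =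
    al%:Z * i%:Z + be%:Z * j%:Z + k%:Z * (al%:Z * p + be%:Z * q) by ring.
  by rewrite pq mulr1.
by rewrite sum_nat_const_nat subn0 mulnA.
Qed.

Lemma class_card_le (d : pixel -> pixel -> nat) (I : binary_image) (k : nat)
    (f : pixel -> nat) : (forall x y, d x y = d y x) ->
  (forall z, I z -> (f z < k)%N) ->
  (forall x y, connected_within d (white I) x y -> f x = f y -> x = y) ->
  components_le d k I.
Proof.
move=> dC fk fI C [[CI Cc] _].
have finj : {in C &, injective f}.
  by move=> x y; rewrite !inE => Cx Cy; apply: fI; exact: Cc.
have e := inj_card_eq finj.
have : f @` C `<=` `I_k by move=> _ [z Cz <-]; apply: fk; exact: CI.
by move=> /subset_card_le; rewrite (card_le_eql e).
Qed.

Lemma linear_components (d : pixel -> pixel -> nat) (al be N : nat) (white : nat -> bool)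
    (rank : nat -> nat) (t1 t2 : int) : (0 < N)%N -> (forall x y, d x y = d y x) ->
  al%:Z * t2 - be%:Z * t1 != 0 ->
  (forall x y (r := residue al be N), Defs.adjacent d x y -> white (r x) -> white (r y) ->
     (r y)%:Z - (r x)%:Z = al%:Z * (y.1 - x.1) + be%:Z * (y.2 - x.2) /\
     (rank (r y))%:Z - (rank (r x))%:Z = t1 * (y.1 - x.1) + t2 * (y.2 - x.2)) ->
  components_le d (count white (iota 0 N)) (linear_image al be N white).
Proof.
move=> N0 dC det st; set I := linear_image _ _ _ _; set r := residue al be N in st.
pose s := [seq i <- iota 0 N | white i].
have rs z : I z -> r z \in s.
  move=> Iz; rewrite mem_filter [X in X && _]Iz mem_iota /= add0n.
  by rewrite -ltz_nat /r residueE // ltz_pmod.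
rewrite -size_filter; apply: (class_card_le (f := fun z => index (r z) s)) => //.
  by move=> z Iz; rewrite index_mem rs.
move=> x y xy; have Ix := connected_l xy; have Iy := connected_r dC xy.
move=> /(congr1 (nth 0%N s)); rewrite !nth_index ?rs // => e.
have : (r y)%:Z - (r x)%:Z = al%:Z * (y.1 - x.1) + be%:Z * (y.2 - x.2) /\
     (rank (r y))%:Z - (rank (r x))%:Z = t1 * (y.1 - x.1) + t2 * (y.2 - x.2).
  case: xy => p [pp <- Ap] {y Iy e}.
  elim: p x pp Ap {Ix} => [|y p IH] x /=; first by rewrite !subrr !mulr0 addr0.
  move=> /andP[xy pp] Ap.
  have [|e1 e2] := IH y pp; first by move=> z zp; apply: Ap; rewrite inE zp orbT.
  have [||e3 e4] := st x y xy.
  - by apply: Ap; rewrite inE eqxx.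
  - by apply: Ap; rewrite !inE eqxx orbT.
  split.
    by rewrite -[LHS](subrKA (r y)%:Z) e1 e3; ring.
  by rewrite -[LHS](subrKA (rank (r y))%:Z) e2 e4; ring.
rewrite -e !subrr => -[e1 e2].
have z1 : (al%:Z * t2 - be%:Z * t1) * (y.1 - x.1) = 0.
  transitivity (t2 * (al%:Z * (y.1 - x.1) + be%:Z * (y.2 - x.2)) -
                be%:Z * (t1 * (y.1 - x.1) + t2 * (y.2 - x.2))); first by ring.
  by rewrite -e1 -e2 !mulr0 subrr.
have z2 : (al%:Z * t2 - be%:Z * t1) * (y.2 - x.2) = 0.
  transitivity (al%:Z * (t1 * (y.1 - x.1) + t2 * (y.2 - x.2)) -
     t1 * (al%:Z * (y.1 - x.1) + be%:Z * (y.2 - x.2))); first by ring.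
  by rewrite -e1 -e2 !mulr0 subrr.
move/eqP: z1; rewrite mulf_eq0 (negbTE det) subr_eq0 => /eqP z1.
move/eqP: z2; rewrite mulf_eq0 (negbTE det) subr_eq0 => /eqP z2.
by rewrite [x]surjective_pairing -z1 -z2 -surjective_pairing.
Qed.

Definition stripes (A L r : nat) : bool := (r < L)%N && (r %% A < A.-1)%N.

Lemma stripes_count A G c N : (0 < A)%N -> (c <= A.-1)%N -> (G * A + c <= N)%N ->
  count (stripes A (G * A + c)) (iota 0 N) = (G * A.-1 + c)%N.
Proof.
move=> A0 cA LN.
have -> : count (stripes A (G * A + c)) (iota 0 N) =
    (\sum_(0 <= r < N) stripes A (G * A + c) r)%N.
  by rewrite -sum1_count [LHS]big_mkcond /index_iota subn0; apply: eq_bigr => r _; case: ifP.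
rewrite (big_cat_nat (leq0n (G * A)%N)) /=; last by rewrite (leq_trans _ LN) // leq_addr.
congr (_ + _)%N.
  rewrite sum_blocks (eq_big_nat _ _ (F2 := fun=> A.-1)) ?sum_nat_const_nat ?subn0 //.
  move=> g /andP[_ gG]; case: A A0 {cA LN} => // A _; rewrite big_nat_recr //=.
  rewrite (eq_big_nat _ _ (F2 := fun=> 1%N)); last first.
    move=> i /andP[_ iA]; rewrite /stripes /= modnMDl modn_small ?iA ?andbT; last exact: ltnW.
    have : (g.+1 * A.+1 <= G * A.+1)%N by rewrite leq_mul2r gG orbT.
    by rewrite mulSn; move=> h; have -> : (g * A.+1 + i < G * A.+1 + c)%N by lia.
  by rewrite sum_nat_const_nat subn0 muln1 /stripes modnMDl modn_small // ltnn andbF addn0.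
rewrite (@big_cat_nat _ _ _ (G * A + c)) ?leq_addr //= [X in (_ + X)%N]big_nat_cond.
rewrite [X in (_ + X)%N]big1 ?addn0; last first.
  by move=> r; rewrite andbT /stripes => /andP[h _]; rewrite ltnNge h.
rewrite -{1}[(G * A)%N]add0n big_addn addKn.
rewrite (eq_big_nat _ _ (F2 := fun=> 1%N)) ?sum_nat_const_nat ?subn0 ?muln1 //.
move=> i /andP[_ ic]; rewrite /stripes addnC ltn_add2l ic modnMDl modn_small; first by rewrite (leq_trans ic).
by rewrite (leq_trans ic) // (leq_trans cA) // leq_pred.
Qed.

Lemma components_le_mono d (I : binary_image) j k : (j <= k)%N ->
  components_le d j I -> components_le d k I.
Proof. by move=> jk h C /h /card_le_trans; apply; rewrite card_le_II. Qed.

Lemma residue_step al be N L (x y : pixel) (w : nat) : (0 < N)%N ->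
  (residue al be N x < L)%N -> (L + w <= N)%N ->
  al%:Z * (y.1 - x.1) + be%:Z * (y.2 - x.2) = w%:Z ->
  residue al be N y = (residue al be N x + w)%N.
Proof.
move=> N0 xL Lw e; apply/eqP; rewrite -eqz_nat residueE // PoszD residueE //; apply/eqP.
have -> : al%:Z * y.1 + be%:Z * y.2 = w%:Z + (al%:Z * x.1 + be%:Z * x.2) by rewrite -e; ring.
rewrite -modzDmr -residueE // -PoszD modz_small; first by rewrite addnC.
by rewrite /=; lia.
Qed.

(* Adjacent white residues differ by exactly [dx + A dy], without wrapping around. *)
Lemma stripes8 (A L : nat) : (1 < A)%N ->
  components_le d8 (count (stripes A L) (iota 0 (L + A.+1)))
    (linear_image 1 A (L + A.+1) (stripes A L)).
Proof.
move=> A1; set N := (L + A.+1)%N; have N0 : (0 < N)%N by rewrite /N addnS.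
have pos (x y : pixel) (dx dy : int) : dx = y.1 - x.1 -> dy = y.2 - x.2 ->
    (dx, dy) \in [:: (1, 0); (0, 1); (1, 1); (-1, 1)] ->
    stripes A L (residue 1 A N x) -> stripes A L (residue 1 A N y) ->
    (residue 1 A N y)%:Z - (residue 1 A N x)%:Z = dx + A%:Z * dy /\
    (residue 1 A N y %/ A)%N%:Z - (residue 1 A N x %/ A)%N%:Z = dy.
  move=> ex ey; rewrite /stripes => dd /andP[xL xA] /andP[yL yA].
  have [w [we wA]] : exists w : nat, dx + A%:Z * dy = w%:Z /\ (w <= A.+1)%N.
    exists (absz (dx + A%:Z * dy)%R); move: dd.
    by rewrite !inE => /or4P[]/eqP[-> ->]; rewrite ?mulr0 ?mulr1; clear -A1; lia.
  have ry : residue 1 A N y = (residue 1 A N x + w)%N.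
    by apply: (residue_step (L := L)) => //; rewrite /N ?leq_add2l // mul1r -ex -ey.
  move: yA; rewrite ry; set r := residue 1 A N x in xL xA *.
  rewrite {1}(divn_eq r A) => yA; split; first by rewrite we; lia.
  rewrite {1}(divn_eq r A); move: yA xA; set q := (r %/ A)%N; set s := (r %% A)%N.
  rewrite -addnA modnMDl divnMDl; last by lia.
  move: dd we; rewrite !inE => /or4P[]/eqP[-> ->]; rewrite ?mulr0 ?mulr1 => we.
  - have -> : w = 1%N by lia.
    move=> _ xA; rewrite divn_small; lia.
  - have -> : w = A by lia.
    move=> _ xA; rewrite divnDr ?dvdnn // divnn divn_small; lia.
  - have -> : w = (1 + A)%N by lia.
    by move=> _ xA; rewrite addnA divnDr ?dvdnn // divnn divn_small; lia.
  - have wE : w = A.-1 by lia.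
    case: s => [|s]; first by rewrite add0n wE modn_small ?ltnn //; lia.
    move=> _ xA; have -> : (s.+1 + w = s + A)%N by lia.
    by rewrite divnDr ?dvdnn // divnn divn_small; lia.
apply: (@linear_components _ _ _ _ _ (fun r => r %/ A)%N 0 1) => //; first exact: d8C.
  by rewrite mulr0 subr0 mulr1.
move=> x y /= /adjacent8P xy Wx Wy; rewrite mul0r mul1r add0r mul1r.
have [dd|dd] : (y.1 - x.1, y.2 - x.2) \in [:: (1, 0); (0, 1); (1, 1); (-1, 1)] \/
   (x.1 - y.1, x.2 - y.2) \in [:: (1, 0); (0, 1); (1, 1); (-1, 1)].
- move: xy; clear; case: x y => [x1 x2] [y1 y2] /=; rewrite !inE !xpair_eqE; lia.
- exact: (pos _ _ _ _ erefl erefl dd Wx Wy).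
have [e1 e2] := pos _ _ _ _ erefl erefl dd Wy Wx.
by split; [rewrite -opprB e1 | rewrite -opprB e2]; ring.
Qed.

Lemma stripes4 (b L : nat) : (0 < b)%N ->
  components_le d4 (count (stripes b.*2.+1 L) (iota 0 (L + b.+1)))
    (linear_image b b.+1 (L + b.+1) (stripes b.*2.+1 L)).
Proof.
move=> b0; set N := (L + b.+1)%N; have N0 : (0 < N)%N by rewrite /N addnS.
set A := b.*2.+1; pose rank r := ((r %/ A).*2 + (b <= r %% A))%N.
have pos (x y : pixel) (dx dy : int) : dx = y.1 - x.1 -> dy = y.2 - x.2 ->
    (dx, dy) \in [:: (1, 0); (0, 1)] ->
    stripes A L (residue b b.+1 N x) -> stripes A L (residue b b.+1 N y) ->
    (residue b b.+1 N y)%:Z - (residue b b.+1 N x)%:Z = b%:Z * dx + b.+1%:Z * dy /\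
    (rank (residue b b.+1 N y))%:Z - (rank (residue b b.+1 N x))%:Z = 1.
  move=> ex ey; rewrite /stripes => dd /andP[xL xA] /andP[yL yA].
  have [w [we wb]] : exists w, b%:Z * dx + b.+1%:Z * dy = w%:Z /\ (w = b \/ w = b.+1).
    move: dd; rewrite !inE => /orP[]/eqP[-> ->]; rewrite ?mulr0 ?mulr1 ?addr0 ?add0r.
      by exists b; split; [|left].
    by exists b.+1; split; [|right].
  have ry : residue b b.+1 N y = (residue b b.+1 N x + w)%N.
    apply: (residue_step (L := L)) => //; last by rewrite -ex -ey.
    by rewrite /N leq_add2l; clear -wb; lia.
  move: yA; rewrite /rank ry; set r := residue b b.+1 N x in xL xA *.
  rewrite {1}(divn_eq r A) => yA; split; first by rewrite we; lia.
  rewrite {1 2}(divn_eq r A); move: yA xA; set q := (r %/ A)%N; set s := (r %% A)%N.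
  rewrite -addnA modnMDl divnMDl //= => yA sA.
  have [sb|sb] := ltnP s b.
    rewrite divn_small ?modn_small /A; try by clear -sb wb; lia.
  have [sw|sw] := ltnP (s + w) A.
    by move: yA; rewrite modn_small // /A; clear -sb wb sw; rewrite /A in sw; lia.
  have [e eE] : exists e, (s + w = e + A)%N by exists (s + w - A)%N; rewrite subnK.
  move: yA; rewrite eE modnDr divnDr ?dvdnn // divnn /=.
  have eb : (e < b)%N by move: eE sA; rewrite /A; clear -wb sb; lia.
  have eA : (e < A)%N by rewrite /A; clear -eb; lia.
  by rewrite !(modn_small eA) (divn_small eA) /= => _; clear -eb; lia.
apply: (@linear_components _ _ _ _ _ rank 1 1) => //; first exact: d4C.
  by rewrite !mulr1; lia.
move=> x y /= /adjacent4P xy Wx Wy; rewrite !mul1r.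
have [dd|dd] : (y.1 - x.1, y.2 - x.2) \in [:: (1, 0); (0, 1)] \/
   (x.1 - y.1, x.2 - y.2) \in [:: (1, 0); (0, 1)].
- move: xy; clear; case: x y => [x1 x2] [y1 y2] /=; rewrite !inE /shift !xpair_eqE /=; lia.
- have [e1 e2] := pos _ _ _ _ erefl erefl dd Wx Wy; split=> //.
  by rewrite e2; move: dd; clear; rewrite !inE !xpair_eqE; lia.
have [e1 e2] := pos _ _ _ _ erefl erefl dd Wy Wx; split.
  by rewrite -opprB e1; ring.
by rewrite -opprB e2; move: dd; clear; rewrite !inE !xpair_eqE; lia.
Qed.

Lemma linear_density (R : realType) (al be N : nat) (white : nat -> bool) (p q : int) :
  (0 < N)%N -> al%:Z * p + be%:Z * q = 1 ->
  (count white (iota 0 N))%:R / N%:R <= white_density R (linear_image al be N white).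
Proof.
move=> N0 pq; have := @density_ge R (linear_image al be N white) N (N * count white (iota 0 N)) N0.
rewrite natrM expr2 -mulf_div divff ?mul1r ?pnatr_eq0 -?lt0n //; apply=> x y.
by rewrite (window_count_linear white N0 pq).
Qed.

Lemma image8 (R : realType) (a b c k : nat) : (1 <= c <= a)%N -> (a * b + c <= k)%N ->
  exists I : binary_image, components_le d8 k I /\
    (a * b + c)%:R / (a * b + c + a + b + 2)%:R <= white_density R I.
Proof.
move=> ca jk; pose L := (b * a.+1 + c)%N; pose N := (L + a.+2)%N.
have cnt : count (stripes a.+1 L) (iota 0 N) = (a * b + c)%N.
  by rewrite stripes_count //= ?leq_addr // 1?mulnC //; case/andP: ca.
exists (linear_image 1 a.+1 N (stripes a.+1 L)); split.
  apply: components_le_mono jk _; rewrite -cnt; apply: stripes8; lia.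
have := @linear_density R 1 a.+1 N (stripes a.+1 L) 1 0 _ _.
rewrite cnt (_ : N = (a * b + c + a + b + 2)%N); last by rewrite /N /L; lia.
by apply; rewrite ?addnS // mulr0.
Qed.

Lemma image4 (R : realType) (b G c k : nat) : (0 < b)%N -> (c <= b.*2)%N ->
  (G * b.*2 + c <= k)%N ->
  exists I : binary_image, components_le d4 k I /\
    (G * b.*2 + c)%:R / (G * b.*2 + c + G + b + 1)%:R <= white_density R I.
Proof.
move=> b0 cb jk; pose A := b.*2.+1; pose L := (G * A + c)%N; pose N := (L + b.+1)%N.
have cnt : count (stripes A L) (iota 0 N) = (G * b.*2 + c)%N.
  by rewrite stripes_count //= leq_addr.
exists (linear_image b b.+1 N (stripes A L)); split.
  by apply: components_le_mono jk _; rewrite -cnt; apply: stripes4.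
have := @linear_density R b b.+1 N (stripes A L) (-1) 1 _ _.
rewrite cnt (_ : N = (G * b.*2 + c + G + b + 1)%N); last by rewrite /N /L /A; lia.
by apply; rewrite ?addn1 //; lia.
Qed.

Definition diamonds (n : nat) : binary_image := fun z =>
  ((z.1 + z.2) %% n.*2%:Z != 0)%Z && ((z.1 - z.2) %% n.*2%:Z != 0)%Z.

Lemma connected_invariant (T : Type) (d : pixel -> pixel -> nat) (A : set pixel)
    (h : pixel -> T) x y :
  (forall x y, A x -> A y -> Defs.adjacent d x y -> h x = h y) ->
  connected_within d A x y -> h x = h y.
Proof.
move=> st [p [pp <- Ap]]; elim: p x pp Ap => [//|z p IH] x /= /andP[xz pp] Ap.
rewrite (st x z) //; last 2 first.
- by apply: Ap; rewrite inE eqxx.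
- by apply: Ap; rewrite !inE eqxx orbT.
by apply: IH => // t tp; apply: Ap; rewrite inE tp orbT.
Qed.

Lemma divz_step (m : nat) (u v : int) : (0 < m)%N -> -1 <= v - u <= 1 ->
  (u %% m%:Z != 0)%Z -> (v %% m%:Z != 0)%Z -> (u %/ m%:Z)%Z = (v %/ m%:Z)%Z.
Proof.
move=> m0 uv u0 v0.
have := divz_eq u m%:Z; have := divz_eq v m%:Z.
have := @modz_ge0 u m%:Z; have := @modz_ge0 v m%:Z.
have := @ltz_pmod u m%:Z; have := @ltz_pmod v m%:Z.
move: u0 v0; set q := (u %/ _)%Z; set q' := (v %/ _)%Z; set s := (u %% _)%Z; set s' := (v %% _)%Z.
move=> s0 s0' /(_ ltac:(lia)) l1 /(_ ltac:(lia)) l2 /(_ ltac:(lia)) g1 /(_ ltac:(lia)) g2 e1 e2.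
have e : (q' - q) * m%:Z = s - s' + (v - u) by rewrite e1 e2; ring.
have [//|ne] := eqVneq q q'.
have [lt|lt] : q' - q >= 1 \/ q - q' >= 1 by clear -ne; lia.
  by have : (q' - q) * m%:Z >= 1 * m%:Z; [apply: ler_wpM2r | clear -e uv l1 l2 g1 g2 s0 s0'; lia].
have : (q - q') * m%:Z >= 1 * m%:Z by apply: ler_wpM2r.
have -> : (q - q') * m%:Z = - ((q' - q) * m%:Z) by ring.
by clear -e uv l1 l2 g1 g2 s0 s0'; lia.
Qed.

Lemma diamonds_components (n k : nat) : (0 < n)%N -> ((n.-1) ^ 2 + n ^ 2 <= k)%N ->
  components_le d4 k (diamonds n).
Proof.
move=> n0 nk; pose m := n.*2; have m0 : (0 < m)%N by rewrite /m double_gt0.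
pose b : nat := m.-1.
pose i (z : pixel) : int := ((z.1 + z.2) %% m%:Z)%Z - 1.
pose j (z : pixel) : int := ((z.1 - z.2) %% m%:Z)%Z - 1.
have ib z : diamonds n z -> 0 <= i z < b%:Z.
  move=> /andP[+ _]; rewrite /i /b -/m; have := @modz_ge0 (z.1 + z.2) m%:Z.
  by have := @ltz_pmod (z.1 + z.2) m%:Z; set s := (_ %% _)%Z; clear -m0; lia.
have jb z : diamonds n z -> 0 <= j z < b%:Z.
  move=> /andP[_ +]; rewrite /j /b -/m; have := @modz_ge0 (z.1 - z.2) m%:Z.
  by have := @ltz_pmod (z.1 - z.2) m%:Z; set s := (_ %% _)%Z; clear -m0; lia.
pose f z := absz ((i z * b%:Z + j z) %/ 2)%Z.
have range z : diamonds n z -> 0 <= i z * b%:Z + j z <= b%:Z * b%:Z - 1.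
  move=> Iz; have /andP[i0 i1] := ib z Iz; have /andP[j0 j1] := jb z Iz.
  have : 0 <= i z * b%:Z by rewrite mulr_ge0.
  have : i z * b%:Z <= (b%:Z - 1) * b%:Z by apply: ler_wpM2r; clear -i1; lia.
  by rewrite mulrBl mul1r; clear -j0 j1; lia.
apply: (class_card_le (f := f)); first exact: d4C.
  move=> z /range rz; apply: leq_trans nk; move: rz; rewrite /f.
  have [a aE] : exists a, n = a.+1 by exists n.-1; rewrite prednK.
  have bE : b%:Z = 2 * a%:Z + 1 by rewrite /b /m aE; clear; lia.
  rewrite bE aE /= -ltz_nat PoszD -!natrXE; clear; nia.
move=> x y xy fxy.
have Ix := connected_l xy; have Iy := connected_r d4C xy.
have same (g : pixel -> int) : (forall x y, Defs.adjacent d4 x y -> -1 <= g y - g x <= 1) ->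
    (forall z, diamonds n z -> (g z %% m%:Z != 0)%Z) ->
    (g x %/ m%:Z)%Z = (g y %/ m%:Z)%Z.
  move=> st nz; apply: (connected_invariant (h := fun z => (g z %/ m%:Z)%Z) _ xy).
  by move=> z t Iz It zt; apply: divz_step; [exact: m0 | exact: st | exact: nz | exact: nz].
have e1 : ((x.1 + x.2) %/ m%:Z)%Z = ((y.1 + y.2) %/ m%:Z)%Z.
  apply: (same (fun z => z.1 + z.2)).
    move=> [x1 x2] [y1 y2] /adjacent4P; clear.
    by rewrite !inE /shift !xpair_eqE /=; lia.
  by move=> z /andP[].
have e2 : ((x.1 - x.2) %/ m%:Z)%Z = ((y.1 - y.2) %/ m%:Z)%Z.
  apply: (same (fun z => z.1 - z.2)).
    move=> [x1 x2] [y1 y2] /adjacent4P; clear.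
    by rewrite !inE /shift !xpair_eqE /=; lia.
  by move=> z /andP[].
have par z : (i z + j z == 0 %[mod 2])%Z.
  rewrite /i /j; have := divz_eq (z.1 + z.2) m%:Z; have := divz_eq (z.1 - z.2) m%:Z.
  set s := (_ %% _)%Z; set q := (_ %/ _)%Z; set s' := (_ %% _)%Z; set q' := (_ %/ _)%Z.
  have -> : m%:Z = 2 * n%:Z by rewrite /m; clear; lia.
  by rewrite !(mulrCA _ 2); set A := q * _; set B := q' * _; clear; lia.
have [||||ij1 ij2] := @half_index_inj (i x) (j x) (i y) (j y) b.
- exact: jb.
- exact: jb.
- by have /eqP -> := par x; have /eqP -> := par y.
- have := range _ Ix; have := range _ Iy; move: fxy; rewrite /f; clear; lia.
have u : x.1 + x.2 = y.1 + y.2.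
  rewrite (divz_eq (x.1 + x.2) m%:Z) (divz_eq (y.1 + y.2) m%:Z) e1; congr (_ + _).
  by move: ij1; rewrite /i => /addIr.
have v : x.1 - x.2 = y.1 - y.2.
  rewrite (divz_eq (x.1 - x.2) m%:Z) (divz_eq (y.1 - y.2) m%:Z) e2; congr (_ + _).
  by move: ij2; rewrite /j => /addIr.
move: u v; clear; case: x y => [x1 x2] [y1 y2] /= u v; apply: pixel_eq; lia.
Qed.

Lemma diamonds_periodic n : periodic (diamonds n) n.*2.
Proof.
split=> x y; rewrite /diamonds /=.
  by rewrite addrAC modzDr [x + _ - y]addrAC modzDr.
by rewrite addrA modzDr opprD addrA -(modzDr (x - y - n.*2%:Z)) subrK.
Qed.

Lemma diamonds_window n x y : (0 < n)%N ->
  (n.*2 ^ 2 + 2 <= window_count (diamonds n) n.*2 x y + 4 * n)%N.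
Proof.
move=> n0; rewrite (window_count_const (diamonds_periodic n) x y 0 0) /window_count.
set m := n.*2; have m0 : (0 < m)%N by rewrite double_gt0.
pose g (t : int) : nat := (t %% m%:Z == 0)%Z.
have gN t : g (t + m%:Z) = g t by rewrite /g modzDr.
pose g' (t : int) : nat := g (- t).
have gN' t : g' (t + m%:Z) = g' t by rewrite /g' opprD -[in RHS](subrK m%:Z (- t)) gN.
have s0 : (\sum_(0 <= j < m) g (0 + j%:Z)%R = 1)%N.
  rewrite big_ltn // big_nat_cond big1 ?addn0; first by rewrite /g addr0 mod0z.
  move=> j /andP[/andP[j0 jm] _]; rewrite /g add0r modz_small //.
  by case: j j0 {jm}.
have s0' : (\sum_(0 <= j < m) g' (0 + j%:Z)%R = 1)%N.
  rewrite big_ltn // big_nat_cond big1 ?addn0; first by rewrite /g' /g addr0 oppr0 mod0z.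
  move=> j /andP[/andP[j0 jm] _]; rewrite -gN' /g' /g add0r.
  have -> : - (j%:Z + m%:Z) = (m - j)%N%:Z + (-2) * m%:Z by clear -jm; lia.
  rewrite addrC modzMDl modz_small; first by clear -j0 jm; lia.
  by clear -j0 jm; lia.
have eq i j : (1 + g (i%:Z + j%:Z)%R * g' (- i%:Z + j%:Z)%R =
    diamonds n (0 + i%:Z, 0 + j%:Z)%R + (g (i%:Z + j%:Z)%R + g' (- i%:Z + j%:Z)%R))%N.
  rewrite /diamonds /g' /g /= !add0r opprD opprK -/m.
  by case: (_ == 0); case: (_ == 0).
have tot : (\sum_(0 <= i < m) \sum_(0 <= j < m) (1 + g (i%:Z + j%:Z)%R * g' (- i%:Z + j%:Z)%R) =
    m * m + \sum_(0 <= i < m) \sum_(0 <= j < m) g (i%:Z + j%:Z)%R * g' (- i%:Z + j%:Z)%R)%N.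
  rewrite -[X in (X * _)%N]subn0 -sum_nat_const_nat -big_split /=; apply: eq_bigr => i _.
  by rewrite big_split /= sum_nat_const_nat subn0 muln1.
have two : (2 <= \sum_(0 <= i < m) \sum_(0 <= j < m) g (i%:Z + j%:Z)%R * g' (- i%:Z + j%:Z)%R)%N.
  have nm : (n < m)%N by rewrite /m -addnn; clear -n0; lia.
  have r1 : (1 <= \sum_(0 <= j < m) g (0%:Z + j%:Z)%R * g' (- 0%:Z + j%:Z)%R)%N.
    by rewrite big_ltn //= /g' /g !addr0 oppr0 mod0z.
  have r2 : (1 <= \sum_(0 <= j < m) g (n%:Z + j%:Z)%R * g' (- n%:Z + j%:Z)%R)%N.
    rewrite (big_cat_nat (leq0n n) (ltnW nm)) /= [X in (_ + X)%N]big_ltn //=.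
    rewrite /g' /g addNr oppr0 mod0z (_ : n%:Z + n%:Z = m%:Z); last by rewrite /m; clear; lia.
    by rewrite modzz /= addnCA.
  rewrite (big_cat_nat (leq0n n) (ltnW nm)) /= (big_ltn n0) [X in (_ + X)%N]big_ltn //=.
  by move: r1 r2; set A := (\sum_(0 <= j < m) _)%N; set B := (\sum_(0 <= j < m) _)%N; clear; lia.
have tot2 : (\sum_(0 <= i < m) \sum_(0 <= j < m) (1 + g (i%:Z + j%:Z)%R * g' (- i%:Z + j%:Z)%R) =
    \sum_(0 <= i < m) \sum_(0 <= j < m) diamonds n (0 + i%:Z, 0 + j%:Z)%R + m * 2)%N.
  rewrite -[m in (m * 2)%N]subn0 -sum_nat_const_nat -big_split /=; apply: eq_bigr => i _.
  rewrite (eq_bigr _ (fun j _ => eq i j)) big_split big_split /=; congr (_ + _)%N.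
  by rewrite (periodic_sum gN _ 0) (periodic_sum gN' _ 0) s0 s0'.
have m2n : (m * 2 = 4 * n)%N by rewrite /m; clear; lia.
by rewrite tot in tot2; rewrite -m2n -tot2 -mulnn leq_add2l.
Qed.

Lemma image_diamond (R : realType) (n k : nat) : (0 < n)%N -> ((n.-1) ^ 2 + n ^ 2 <= k)%N ->
  exists I : binary_image, components_le d4 k I /\
    (n.-1 ^ 2 + n ^ 2)%:R / (2 * n ^ 2)%:R <= white_density R I.
Proof.
move=> n0 nk; exists (diamonds n); split; first exact: diamonds_components.
have m0 : (0 < n.*2)%N by rewrite double_gt0.
apply: (@le_trans _ _ ((2 * (n.-1 ^ 2 + n ^ 2))%:R / n.*2%:R ^+ 2)); last first.
  apply: density_ge => // x y; have := diamonds_window x y n0.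
  by clear -n0; case: n n0 => // n _ /=; rewrite -muln2 !expnS expn0; nia.
have -> : n.*2%:R ^+ 2 = (2 * (2 * n ^ 2))%:R :> R by rewrite -natrX -mul2n expnMn mulnA.
by rewrite !natrM -mulf_div divff ?pnatr_eq0 // mul1r.
Qed.

(** * The maxima F8 and F4 *)

Lemma even_side_bound (Q q j jm : nat) : (1 <= q)%N -> (q < Q)%N ->
  (2 * Q ^ 2 - Q <= 4 * jm)%N -> (2 * j <= q ^ 2 + 1)%N ->
  (2 * j * Q <= jm * (2 * q))%N.
Proof.
move=> q1 qQ hj jq.
have [[Q2 q2]|big] : (Q = 2 /\ q = 1)%N \/ (2 + q <= 2 * q * (Q - q))%N.
  have [c cE] : exists c, Q = (q + 1 + c)%N by exists (Q - q - 1)%N; lia.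
  subst Q; have -> : (q + 1 + c - q = c + 1)%N by lia.
  have [q2|q2] := leqP 2 q; first by right; nia.
  have -> : q = 1%N by lia.
  by case: c {qQ hj} => [|c]; [left | right; lia].
- subst Q q; have j1 : (j <= 1)%N by lia.
  have jm2 : (2 <= jm)%N by lia.
  by lia.
have [c cE] : exists c, Q = (q + c)%N by exists (Q - q)%N; lia.
subst Q; rewrite addKn in big.
have h : (2 * (q ^ 2 + 1) * (q + c) <= q * (2 * (q + c) ^ 2 - (q + c)))%N.
  have -> : (2 * (q + c) ^ 2 - (q + c) = (q + c) * (2 * (q + c) - 1))%N by nia.
  rewrite mulnCA mulnC leq_mul2l; apply/orP; right.
  have : (2 * q ^ 2 + 2 <= 2 * q * (q + c) - q)%N by nia.
  by nia.
have := leq_mul (leqnn q) hj; have := leq_mul jq (leqnn (q + c)); nia.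
Qed.

Lemma odd_side_bound (Q P j jm : nat) : (P < Q)%N ->
  (2 * Q ^ 2 - Q <= 4 * jm)%N -> (2 * j <= P ^ 2 + P)%N ->
  (2 * j * Q <= jm * (2 * P + 1))%N.
Proof.
move=> PQ hj jP.
have h : (4 * (P ^ 2 + P) <= (2 * P + 1) * (2 * Q - 1))%N by nia.
have e : (2 * Q ^ 2 - Q = Q * (2 * Q - 1))%N by nia.
rewrite e in hj.
have := leq_mul (leqnn Q) h; have := leq_mul (leqnn (2 * P + 1)) hj.
have := leq_mul jP (leqnn Q); nia.
Qed.

(* [2 Q] is the value of [ceil (2 sqrt (2 j - 1))] at [j = s]. *)
Lemma S_maximum (Q s k j m : nat) : (1 <= Q)%N -> (Q ^ 2 <= 2 * s <= Q ^ 2 + 1)%N ->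
  (4 * k <= 4 * s + Q)%N -> (2 * Q ^ 2 - Q <= 4 * minn k s)%N ->
  (1 <= j <= k)%N -> (4 * (2 * j - 1) <= m ^ 2)%N ->
  (2 * j * Q <= minn k s * m)%N.
Proof.
move=> Q1 /andP[s1 s2] kQ jlow /andP[j1 jk] jm.
have [mQ|mQ] := leqP (2 * Q) m.
  have [jj|jj] := leqP j (minn k s).
    by rewrite -mulnA mulnCA leq_mul.
  have sk : minn k s = s by move: jj; rewrite /minn; case: ifP; lia.
  rewrite sk in jj *.
  have m1 : (2 * Q + 1 <= m)%N.
    rewrite leqNgt; apply/negP => m2; have mE : m = (2 * Q)%N by lia.
    by rewrite mE in jm; nia.
  apply: leq_trans (leq_mul (leqnn s) m1).
  have j4 : (4 * j <= 4 * s + Q)%N by lia.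
  have h := leq_mul j4 (leqnn Q); rewrite -mulnn in s1; clear -s1 h.
  by lia.
have m0 : (1 <= m)%N by case: m jm {mQ} => // ; clear -j1; lia.
have [om|em] := boolP (odd m).
  have mE : m = (2 * (m %/ 2) + 1)%N by lia.
  rewrite mE; apply: odd_side_bound => //; first by lia.
  move: (m %/ 2)%N mE => P mE; rewrite mE in jm.
  have ev : ~~ odd (P ^ 2 + P) by rewrite oddD oddX /=; case: (odd P).
  have e : ((2 * P + 1) ^ 2 = 4 * P ^ 2 + 4 * P + 1)%N by ring.
  by rewrite e in jm; clear -jm ev; lia.
have mE : m = (2 * (m %/ 2))%N by lia.
rewrite mE; apply: even_side_bound => //; [by lia | by lia |].
move: (m %/ 2)%N mE => P mE; rewrite mE in jm.
have e : ((2 * P) ^ 2 = 4 * P ^ 2)%N by ring.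
by rewrite e in jm; clear -jm; lia.
Qed.

Lemma rectangle_decomposition (j m : nat) : (1 <= j)%N -> (4 * j <= m ^ 2)%N ->
  (forall m', (4 * j <= m' ^ 2)%N -> (m <= m')%N) ->
  exists a b c : nat, [/\ (1 <= c <= a)%N, j = (a * b + c)%N & (a + b + 1)%N = m].
Proof.
move=> j1 jm mmin; pose a := (m %/ 2)%N.
have lo : ((m - 1) ^ 2 < 4 * j)%N.
  rewrite ltnNge; apply/negP => /mmin; case: m jm {mmin a} => [|m]; first by lia.
  by rewrite subn1 ltnn.
have m2 : (2 <= m)%N by case: m jm {mmin a lo} => [|[|m]] //; lia.
have [em|om] : m = (2 * a)%N \/ m = (2 * a + 1)%N by rewrite /a; lia.
  have a1 : (1 <= a)%N by lia.
  have hi : (j <= a * a)%N by rewrite em in jm; nia.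
  have lo' : (a * (a - 1) < j)%N by rewrite em in lo; clear -lo a1; nia.
  exists a, (a - 1)%N, (j - a * (a - 1))%N; split; last by lia.
    by apply/andP; split; [lia | clear -hi lo' a1; nia].
  by rewrite subnKC // ltnW.
have a1 : (1 <= a)%N by lia.
have hi : (j <= a * (a + 1))%N by rewrite om in jm; nia.
have lo' : (a * a < j)%N by rewrite om addnK in lo; nia.
exists a, a, (j - a * a)%N; split; last by lia.
  by apply/andP; split; [lia | clear -hi; nia].
by rewrite subnKC // ltnW.
Qed.

Lemma ceil_sqrtP (R : realType) (x : nat) : exists m : nat,
  [/\ (Num.ceil (2 * Num.sqrt (x%:R : R)))%:~R = m%:R :> R, (4 * x <= m ^ 2)%N
    & forall m', (4 * x <= m' ^ 2)%N -> (m <= m')%N].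
Proof.
set y := 2 * Num.sqrt _; have y0 : 0 <= y by rewrite mulr_ge0 // sqrtr_ge0.
have c0 : (0 <= Num.ceil y)%R by rewrite -(ler_int R) (le_trans y0) // ceil_ge.
have y2 : y ^+ 2 = (4 * x)%:R by rewrite exprMn sqr_sqrtr // natrM -natrX.
exists (absz (Num.ceil y)); have cE : (absz (Num.ceil y))%:Z = Num.ceil y by rewrite gez0_abs.
have cR : (Num.ceil y)%:~R = (absz (Num.ceil y))%:R :> R by rewrite -{1}cE pmulrn.
split=> //.
  rewrite -(ler_nat R) natrX -cR -y2 lerXn2r ?nnegrE ?ler0z //.
  exact: ceil_ge.
move=> m' h; rewrite -lez_nat cE ceil_le_int -pmulrn.
by rewrite -(ler_pXn2r (n := 2)) ?nnegrE // y2 -natrX ler_nat.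
Qed.

Lemma components_le_black (d : pixel -> pixel -> nat) (k : nat) :
  (forall x y, d x y = d y x) -> components_le d k (fun=> false).
Proof.
by move=> dC; apply: (class_card_le (f := fun=> 0%N)) => // x y /connected_l.
Qed.

Lemma density_le1 (R : realType) (I : binary_image) : white_density R I <= 1.
Proof.
apply: (@density_le _ _ _ 0) => // n; rewrite mul1r addn0 ler_nat size_filter.
exact: count_size.
Qed.

Lemma density_ge0 (R : realType) (I : binary_image) : 0 <= white_density R I.
Proof. by have := @density_ge R I 1 0 isT (fun _ _ => isT); rewrite mul0r. Qed.

Lemma Phi_le (R : realType) (d : pixel -> pixel -> nat) (k : nat) (l : R) :
  (forall x y, d x y = d y x) ->
  (forall I, components_le d k I -> white_density R I <= l) -> Phi R d k <= l.
Proof.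
move=> dC h; apply: ge_sup.
  by exists (white_density R (fun=> false)), (fun=> false); first exact: components_le_black.
by move=> _ [I /h Il <-].
Qed.

Lemma Phi_ge (R : realType) (d : pixel -> pixel -> nat) (k : nat) (I : binary_image) :
  components_le d k I -> white_density R I <= Phi R d k.
Proof.
move=> Ik; apply: ub_le_sup; last by exists I.
by exists 1 => _ [J _ <-]; exact: density_le1.
Qed.

Lemma F8_ge (R : realType) (k j m : nat) : (1 <= j <= k)%N -> (4 * j <= m ^ 2)%N ->
  j%:R / (j + m + 1)%:R <= F8 R k.
Proof.
move=> jk jm; have [c [cE _ cmin]] := ceil_sqrtP R j; have cm := cmin _ jm.
apply: le_trans (_ : j%:R / (j%:R + c%:R + 1) <= _).
  rewrite ler_wpM2l // lef_pV2 ?posrE; last 2 first.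
  - by rewrite addn1 ltr0n.
  - by rewrite -natrD natr1 ltr0n.
  by rewrite -natrD natr1 -addn1 ler_nat; lia.
pose F i : R := i%:R / (i%:R + (Num.ceil (2 * Num.sqrt (i%:R : R)))%:~R + 1).
rewrite -cE -[leLHS]/(F j) /F8; apply: (le_bigmax_seq 0 j xpredT F) => //.
by rewrite mem_index_iota ltnS.
Qed.

Lemma F8_le (R : realType) (k : nat) (l : R) : 0 <= l ->
  (forall j m : nat, (1 <= j <= k)%N -> (4 * j <= m ^ 2)%N ->
     (forall m', (4 * j <= m' ^ 2)%N -> (m <= m')%N) -> j%:R / (j + m + 1)%:R <= l) ->
  F8 R k <= l.
Proof.
move=> l0 h; rewrite /F8 big_seq; apply: bigmax_le => // j; rewrite mem_index_iota => jk.
have [m [-> jm mmin]] := ceil_sqrtP R j.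
by rewrite -natrD natr1 -addn1; apply: h; rewrite // -ltnS.
Qed.

Lemma F4_ge (R : realType) (k j m : nat) : (1 <= j <= k)%N -> (4 * (2 * j - 1) <= m ^ 2)%N ->
  j%:R / (j%:R + m%:R / 2) <= F4 R k.
Proof.
move=> jk jm; have [c [cE _ cmin]] := ceil_sqrtP R (2 * j - 1); have cm := cmin _ jm.
have j0 : 0 < j%:R :> R by rewrite ltr0n; case/andP: jk.
apply: le_trans (_ : j%:R / (j%:R + c%:R / 2) <= _).
  rewrite ler_wpM2l // lef_pV2 ?posrE; last 2 first.
  - by rewrite ltr_pwDl // divr_ge0.
  - by rewrite ltr_pwDl // divr_ge0.
  by rewrite lerD2l ler_wpM2r // ler_nat.
have e : (2 * j - 1)%N%:R = 2 * j%:R - 1 :> R.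
  by rewrite natrB ?natrM //; case/andP: jk => j1 _; lia.
pose F i : R := i%:R / (i%:R + (Num.ceil (2 * Num.sqrt (2 * i%:R - 1 : R)))%:~R / 2).
rewrite -cE e -[leLHS]/(F j) /F4; apply: (le_bigmax_seq 0 j xpredT F) => //.
by rewrite mem_index_iota ltnS.
Qed.

Lemma F4_le (R : realType) (k : nat) (l : R) : 0 <= l ->
  (forall j m : nat, (1 <= j <= k)%N -> (4 * (2 * j - 1) <= m ^ 2)%N ->
     j%:R / (j%:R + m%:R / 2) <= l) ->
  F4 R k <= l.
Proof.
move=> l0 h; rewrite /F4 big_seq; apply: bigmax_le => // j; rewrite mem_index_iota => jk.
have [m [+ jm mmin]] := ceil_sqrtP R (2 * j - 1).
have -> : (2 * j - 1)%N%:R = 2 * j%:R - 1 :> R.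
  by rewrite natrB ?natrM //; lia.
by move=> ->; apply: h; rewrite // -ltnS.
Qed.

Lemma Phi8_eq (R : realType) (k : nat) : (1 <= k)%N -> Phi R d8 k = F8 R k.
Proof.
move=> k1; have F0 : 0 <= F8 R k.
  by apply: le_trans (@F8_ge R k 1 2 _ _) => //; rewrite divr_ge0.
apply/eqP; rewrite eq_le; apply/andP; split.
  apply: Phi_le => [|I Ik]; first exact: d8C.
  apply: (density_le (r := 1) F0) => n; apply: (bound8 n Ik F0) => j w h jk jwh.
  rewrite -ler_pdivrMr; last by rewrite addn1 ltr0n.
  rewrite -(addnA j w h); apply: F8_ge => //.
  have [am _] := nat_AGM2 w h; apply: leq_trans am.
  by rewrite leq_mul2l.
apply: F8_le; first by apply: le_trans (Phi_ge R (components_le_black k d8C)); apply: (@density_ge0 R).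
move=> j m /andP[j1 jk] jm mmin.
have [a [b [c [ca jE mE]]]] := rectangle_decomposition j1 jm mmin.
have [|I [Ik]] := @image8 R a b c k ca; first by rewrite -jE.
rewrite -jE => h; apply: le_trans (Phi_ge R Ik); apply: le_trans h.
by rewrite -mE (_ : (j + (a + b + 1) + 1 = j + a + b + 2)%N) //; lia.
Qed.

Lemma F4_ge0 (R : realType) (k : nat) : (1 <= k)%N -> 0 <= F4 R k.
Proof. by move=> k1; apply: le_trans (@F4_ge R k 1 2 _ _) => //; rewrite divr_ge0. Qed.

Lemma Phi4_le (R : realType) (k : nat) : (1 <= k)%N -> Phi R d4 k <= F4 R k.
Proof.
move=> k1; have F0 := F4_ge0 R k1.
apply: Phi_le => [|I Ik]; first exact: d4C.
apply: (density_le (r := 1) F0) => n; apply: (bound4 n Ik F0) => j a b jk jab.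
have j0 : 0 < j%:R :> R by rewrite ltr0n; case/andP: jk.
rewrite -ler_pdivrMr; last by rewrite ltr_pwDl // divr_ge0.
apply: F4_ge => //; have [am _] := nat_AGM2 a b; apply: leq_trans am.
by rewrite leq_mul2l; lia.
Qed.

Lemma Phi4_ge (R : realType) (Q s k : nat) (I : binary_image) :
  (1 <= Q)%N -> (Q ^ 2 <= 2 * s <= Q ^ 2 + 1)%N ->
  (4 * k <= 4 * s + Q)%N -> (2 * Q ^ 2 - Q <= 4 * minn k s)%N ->
  components_le d4 k I ->
  (minn k s)%:R / (minn k s + Q)%:R <= white_density R I ->
  F4 R k <= Phi R d4 k.
Proof.
move=> Q1 sQ kQ jQ Ik Id; have h := le_trans Id (Phi_ge R Ik).
have Q0 : 0 < Q%:R :> R by rewrite ltr0n.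
apply: F4_le => [|j m jk jm].
  by apply: le_trans h; rewrite divr_ge0.
apply: le_trans h; have key := S_maximum Q1 sQ kQ jQ jk jm.
have j0 : 0 < j%:R :> R by rewrite ltr0n; case/andP: jk.
rewrite natrD ler_pdivrMr ?ltr_pwDl ?divr_ge0 //.
rewrite mulrAC ler_pdivlMr ?ltr_wpDl //.
move: key; rewrite -(ler_nat R) !natrM; set J := j%:R; set M := m%:R; set S := (minn k s)%:R.
by set q := Q%:R; nra.
Qed.

Lemma nat_rat_le (a b : nat) : (a%:R <= b%:R :> rat) = (a <= b)%N.
Proof. exact: ler_nat. Qed.

Lemma Phi4_S0 (R : realType) (n k : nat) : (0 < n)%N ->
  (2 * (n.-1 ^ 2 + n ^ 2) <= 2 * k + n)%N -> (2 * k <= 2 * (n.-1 ^ 2 + n ^ 2) + n.-1)%N ->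
  F4 R k <= Phi R d4 k.
Proof.
case: n => // n _ /=; set s := (n ^ 2 + n.+1 ^ 2)%N => lo hi.
have sE : (2 * s = (2 * n + 1) ^ 2 + 1)%N by rewrite /s; clear; lia.
have Q1 : (1 <= 2 * n + 1)%N by rewrite addn1.
have sQ : ((2 * n + 1) ^ 2 <= 2 * s <= (2 * n + 1) ^ 2 + 1)%N by clear -sE; lia.
have kQ : (4 * k <= 4 * s + (2 * n + 1))%N by clear -hi; lia.
have jQ : (2 * (2 * n + 1) ^ 2 - (2 * n + 1) <= 4 * minn k s)%N by clear -sE lo; lia.
have [ks|ks] := leqP s k.
  have [I [Ik Id]] := @image_diamond R n.+1 k isT ks.
  apply: (Phi4_ge Q1 sQ kQ jQ Ik); rewrite (minn_idPr ks).
  by rewrite (_ : (s + (2 * n + 1) = 2 * n.+1 ^ 2)%N) //; rewrite /s; clear; lia.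
have n1 : (0 < n)%N by rewrite lt0n; apply/eqP => n0; move: ks lo; rewrite /s n0; clear; lia.
have lo2 : (n * n.*2 <= k)%N by move: lo; rewrite /s; clear; nia.
have c1 : (k - n * n.*2 <= n.*2)%N by move: ks; rewrite /s; clear; nia.
have [|I [Ik Id]] := @image4 R n n (k - n * n.*2) k n1 c1; first by rewrite subnKC.
apply: (Phi4_ge Q1 sQ kQ jQ Ik); rewrite (minn_idPl (ltnW ks)).
move: Id; rewrite subnKC //; congr (_ / _%:R <= _); clear; lia.
Qed.

Lemma Phi4_S2 (R : realType) (n k : nat) : (0 < n)%N ->
  (2 * (2 * n ^ 2) <= 2 * k + n)%N -> (2 * k <= 2 * (2 * n ^ 2) + n)%N ->
  F4 R k <= Phi R d4 k.
Proof.
case: n => // n _; set s := (2 * n.+1 ^ 2)%N => lo hi.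
have sE : (2 * s = (2 * n.+1) ^ 2)%N by rewrite /s; clear; lia.
have Q1 : (1 <= 2 * n.+1)%N by [].
have sQ : ((2 * n.+1) ^ 2 <= 2 * s <= (2 * n.+1) ^ 2 + 1)%N by clear -sE; lia.
have kQ : (4 * k <= 4 * s + (2 * n.+1))%N by clear -hi; lia.
have jQ : (2 * (2 * n.+1) ^ 2 - (2 * n.+1) <= 4 * minn k s)%N by clear -sE lo; lia.
have lo2 : (n * n.+1.*2 <= minn k s)%N by rewrite leq_min; move: lo; rewrite /s; clear; nia.
have c1 : (minn k s - n * n.+1.*2 <= n.+1.*2)%N.
  by have := geq_minr k s; rewrite /s; clear; nia.
have [|I [Ik Id]] := @image4 R n.+1 n (minn k s - n * n.+1.*2) k isT c1.
  by rewrite subnKC // geq_minl.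
apply: (Phi4_ge Q1 sQ kQ jQ Ik).
move: Id; rewrite subnKC //; congr (_ / _%:R <= _); clear; lia.
Qed.

Lemma Phi4_U (R : realType) (P T k : nat) : (2 <= P)%N -> (2 * T = P * P.+1)%N ->
  (T <= k)%N -> (4 * k <= 4 * T + P)%N -> Phi R d4 k < F4 R k.
Proof.
move=> P2 TE Tk kT; have T1 : (1 <= T)%N by case: T TE {Tk kT} => //; clear -P2; nia.
have k1 : (1 <= k)%N := leq_trans T1 Tk.
have [C [r [C0 H]]] := bound4_strict P2 TE k1 kT.
set X := (4 * (k * T) + k * (2 * (2 * P + 1)))%N in H.
set Y := (4 * (k * T))%N in H.
have X0 : 0 < (X * C + 1)%:R :> R by rewrite ltr0n addn1.
have l0 : 0 <= (C * Y)%:R / (X * C + 1)%:R :> R by rewrite divr_ge0.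
apply: (@le_lt_trans _ _ ((C * Y)%:R / (X * C + 1)%:R)).
  apply: Phi_le => [|I Ik]; first exact: d4C.
  apply: (density_le (r := r) l0) => n.
  by rewrite mulrAC ler_pdivlMr // mulrC -!natrM ler_nat; exact: H.
have FT : T%:R / (T%:R + (2 * P + 1)%:R / 2) <= F4 R k.
  apply: F4_ge; first by rewrite T1 Tk.
  by rewrite mulnBr mulnA -[(4 * 2)%N]/(4 * 2)%N -mulnA TE; clear; nia.
apply: lt_le_trans FT.
have TR : 1 <= T%:R :> R by rewrite ler1n.
have kR : 1 <= k%:R :> R by rewrite ler1n.
have CR : 1 <= C%:R :> R by rewrite ler1n.
have PR : 0 <= (2 * P + 1)%:R :> R by [].
rewrite ltr_pdivrMr // mulrAC ltr_pdivlMr; last by rewrite ltr_pwDl ?divr_ge0 // (lt_le_trans ltr01).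
rewrite /X /Y [(_ + 1)%:R]natrD !natrM natrD !natrM.
rewrite -subr_gt0 (_ : _ - _ = T%:R); first exact: lt_le_trans TR.
by field.
Qed.

Lemma S_setP (k : nat) : S_set k -> exists n : nat, (0 < n)%N /\
  (((2 * (n.-1 ^ 2 + n ^ 2) <= 2 * k + n)%N /\ (2 * k <= 2 * (n.-1 ^ 2 + n ^ 2) + n.-1)%N) \/
   ((2 * (2 * n ^ 2) <= 2 * k + n)%N /\ (2 * k <= 2 * (2 * n ^ 2) + n)%N)).
Proof.
move=> [_ [n /= n1 h]]; exists n; split=> //; case: n n1 h => // n _.
have nn : n.+1%:R = n%:R + 1 :> rat by rewrite natr1.
case=> /=; rewrite in_itv /= /s0 /s2 => /andP[lo hi]; [left|right]; split; rewrite -nat_rat_le.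
- by rewrite !(natrD, natrM, natrX) nn; move: lo; rewrite nn; lra.
- by rewrite !(natrD, natrM, natrX) nn; move: hi; rewrite nn; lra.
- by rewrite !(natrD, natrM, natrX) nn; move: lo; rewrite nn; lra.
- by rewrite !(natrD, natrM, natrX) nn; move: hi; rewrite nn; lra.
Qed.

Lemma U_setP (k : nat) : U_set k -> exists P T : nat,
  [/\ (2 <= P)%N, (2 * T = P * P.+1)%N, (T <= k)%N & (4 * k <= 4 * T + P)%N].
Proof.
move=> [/= k2 [n /= n1 h]]; case: n n1 h => // n _.
have nn : n.+1%:R = n%:R + 1 :> rat by rewrite natr1.
case=> /=; rewrite in_itv /= /s1 /s3 => /andP[lo hi].
  have Tk : (n.+1 * (2 * n + 1) <= k)%N.
    by rewrite -nat_rat_le !(natrD, natrM) nn; move: lo; rewrite nn; lra.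
  have kT : (2 * k <= 2 * (n.+1 * (2 * n + 1)) + n)%N.
    by rewrite -nat_rat_le !(natrD, natrM) nn; move: hi; rewrite nn; lra.
  exists (2 * n + 1)%N, (n.+1 * (2 * n + 1))%N; split=> //; last by clear -kT; lia.
    by case: n kT {lo hi nn Tk} => [|n]; clear -k2; lia.
  by clear; lia.
have Tk : (n.+1 * (2 * n + 3) <= k)%N.
  by rewrite -nat_rat_le !(natrD, natrM) nn; move: lo; rewrite nn; lra.
have kT : (2 * k <= 2 * (n.+1 * (2 * n + 3)) + n.+1)%N.
  by rewrite -nat_rat_le !(natrD, natrM) nn; move: hi; rewrite nn; lra.
exists (2 * n + 2)%N, (n.+1 * (2 * n + 3))%N; split=> //; last by clear -kT; lia.
- by rewrite addn2.
- by clear; lia.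
Qed.

Theorem theorem1p1 (R : realType) :
  [/\ forall k : nat, (1 <= k)%N -> Phi R d8 k = F8 R k /\ Phi R d4 k <= F4 R k,
      forall k : nat, S_set k -> Phi R d4 k = F4 R k
    & forall k : nat, U_set k -> Phi R d4 k < F4 R k].
Proof.
split=> [k k1|k Sk|k /U_setP [P [T [P2 TE Tk kT]]]].
- by split; [exact: Phi8_eq | exact: Phi4_le].
- have k1 : (1 <= k)%N by case: Sk.
  apply/eqP; rewrite eq_le Phi4_le //=.
  have [n [n0 [[lo hi]|[lo hi]]]] := S_setP Sk.
    exact: Phi4_S0 n0 lo hi.
  exact: Phi4_S2 n0 lo hi.
- exact: Phi4_U P2 TE Tk kT.
Qed.
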